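(* Let $\beta>1$ be a Pisot number and let $m>\beta$ be an integer. Then there exists a constant $\gamma=\gamma(\beta,m)>0$ such that $$\lim_{n\to\infty}\frac{\log \mathcal N_n(x;\beta)}{n}=\gamma\qquad\text{for Lebesgue-a.e. } x\in I_\beta=\Bigl[0,\frac{m-1}{\beta-1}\Bigr].$$
   Context: A Pisot number is an algebraic integer $\beta>1$ all of whose other Galois conjugates have modulus strictly less than $1$ (rational integers $\beta\ge 2$ are included). For a real $\beta>1$ and an integer $m>\beta$, put $I_\beta=[0,\frac{m-1}{\beta-1}]$. For $x\in I_\beta$ let $\mathcal E_n(x;\beta)$ be the set of words $(\varepsilon_1,\dots,\varepsilon_n)\in\{0,1,\dots,m-1\}^n$ for which there exists $(\varepsilon_{n+1},\varepsilon_{n+2},\dots)\in\{0,1,\dots,m-1\}^{\mathbb N}$ with $x=\sum_{k=1}^\infty\varepsilon_k\beta^{-k}$, and let $\mathcal N_n(x;\beta)=\#\mathcal E_n(x;\beta)$. *)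

(* Defs.v *)
From HB Require Import structures.
From mathcomp Require Import all_boot all_order all_algebra.
From mathcomp Require Import all_classical all_reals all_analysis.
From mathcomp Require Import complex.

Set Implicit Arguments.
Unset Strict Implicit.
Unset Printing Implicit Defensive.

Import Order.TTheory GRing.Theory Num.Theory numFieldNormedType.Exports.

Local Open Scope classical_set_scope.
Local Open Scope ring_scope.

(* An irreducible rational polynomial vanishing at both points is, up to a
   scalar, their common minimal polynomial over the rationals. *)
Definition galois_conjugate (K : numFieldType) (x y : K) : Prop :=
  exists p : {poly rat},
    [/\ irreducible_poly p, root (map_poly ratr p) x & root (map_poly ratr p) y].

Definition Pisot (R : realType) (beta : R) : Prop :=
  [/\ integralOver (intr : int -> R) beta,
      1 < beta
    & forall z : R[i],
        galois_conjugate (beta%:C)%C z -> z != (beta%:C)%C -> `|z| < 1].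

(* The digit eps_(k+1) is e k. *)
Definition is_expansion (R : realType) (beta : R) (m : nat) (x : R)
    (e : nat -> 'I_m) : Prop :=
  series (fun k => (e k)%:R * beta ^- k.+1) @ \oo --> x.

Definition prefixes (R : realType) (beta : R) (m n : nat) (x : R) :
    {set n.-tuple 'I_m} :=
  [set w : n.-tuple 'I_m |
    `[< exists e : nat -> 'I_m,
          (forall i : 'I_n, e i = tnth w i) /\ is_expansion beta x e >]]%SET.

Definition nb_prefixes (R : realType) (beta : R) (m n : nat) (x : R) : nat :=
  #|prefixes beta m n x|.

(* Main.v *)
Require Import Defs.
From HB Require Import structures.
From mathcomp Require Import all_boot all_order all_algebra.
From mathcomp Require Import all_classical all_reals all_analysis.
From mathcomp Require Import complex separable.
From mathcomp Require Import ring lra zify.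

Set Implicit Arguments.
Unset Strict Implicit.
Unset Printing Implicit Defensive.

Import Order.TTheory GRing.Theory Num.Theory numFieldNormedType.Exports.

(** A word of length [n] is a prefix of an expansion of [x] exactly when the
    residual [beta^n x - sum_k eps_k beta^(n-k)] falls back into the closed
    interval [0, top] of numbers that have an expansion. Outside countably many
    [x] it never hits an end point ([nb_prefixesE]), so that the number to be
    studied is the length of [residuals n x], the list with multiplicity of the
    residuals of [x] in the open interval.

    The Pisot hypothesis enters once, through Garsia's lemma
    ([res_diff_finite]): any two residuals of the same [x] at the same time
    differ by an element of a finite set [V]. Hence the number of distinct
    residuals is bounded. A point for which this number is maximal has, whenever
    it is itself a residual of some [x], all the descendants of [x], since [x]
    cannot have more of them. Treating the elements
    of [V] one after the other produces an interval ]a, b[ and a time [t] such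
    that, whenever a residual of [x] lies in ]a, b[, all the residuals of [x] at
    that time have the same descendants after [t] steps ([good_itv]). This makes
    the counts quasi-multiplicative at these times, up to the factor [m^t]
    ([size_res_quasi_mul]). As the counts can also be made large on ]a, b[, they
    at least double after a fixed time, which gives a positive rate.

    The rest is a law of large numbers. An inverse branch of the expansion
    process is an affine map [y |-> beta^-n y + c]. Filling an interval greedily
    with images of ]a, b[ under such branches, then the gaps, and so on, covers
    almost all of it ([filling_ex]). Applied to ]a, b[ itself this is a full
    branched piecewise affine map of ]a, b[ for which the successive branches of
    a Lebesgue random point are independent, the branch of length [n] having
    probability [beta^-n], and for which the length has an exponential moment.
    Along the itinerary of a point, quasi-multiplicativity writes the logarithm
    of the count as a sum over independent blocks of [K] branches, up to an error
    that is bounded for each block. A Chernoff bound and the Borel-Cantelli lemma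
    ([block_sums_ae]) then squeeze the rate between bounds that meet when [K]
    tends to infinity ([rate_upper], [rate_lower]); the common value is the mean
    logarithm of the count per branch divided by the mean length of a branch
    ([rate_ex]). Finally almost every point of [0, top] lies in an image of
    ]a, b[, and the rate is the same there ([rate_ae_top]). *)

Local Open Scope classical_set_scope.
Local Open Scope ring_scope.

(** * Residuals and inverse branches *)

(** A class, so that the two inequalities are passed silently with the parameters. *)
Class expanding (R : realType) (beta : R) (m : nat) : Prop :=
  Expanding { base_gt1 : 1 < beta; base_lt : beta < m%:R }.

Section Residuals.
Context (R : realType) (beta : R) (m : nat).

Definition top : R := (m%:R - 1) / (beta - 1).

(** The open interval is used instead of the closed one so that a residual
    that is present at [x] stays present near [x]. *)
Definition inI (x : R) : bool := 0 < x < top.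

(** The recursion consumes the first digit. Only the last residual is
    tested: if it lies in the open interval, so do all the preceding ones. *)
Fixpoint residuals n x : seq R :=
  if n is n'.+1 then flatten [seq residuals n' (beta * x - d%:R) | d <- iota 0 m]
  else if inI x then [:: x] else [::].

Definition bapp (a : nat * R) (y : R) : R := beta ^- a.1 * y + a.2.

(** [bapp a] has the form [y |-> beta^-n y + c] and undoes [n] steps: the
    points of its image have the residual [y] at time [n]. Working with the
    constant [c] makes the digits themselves superfluous. *)
Definition is_branch (a : nat * R) : Prop :=
  forall y, inI y -> y \in residuals a.1 (bapp a y).

Definition bcomp (a b : nat * R) : nat * R :=
  ((a.1 + b.1)%N, beta ^- a.1 * b.2 + a.2).

Context {hb : expanding beta m}.
Local Notation b1 := (@base_gt1 _ _ _ hb).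
Local Notation bm := (@base_lt _ _ _ hb).

Lemma top_gt1 : 1 < top.
Proof. by rewrite /top ltr_pdivlMr ?subr_gt0 ?b1// mul1r ltrD2r bm. Qed.

Lemma top_gt0 : 0 < top. Proof. exact: lt_trans ltr01 top_gt1. Qed.

Lemma topE : top * (beta - 1) = m%:R - 1.
Proof. by rewrite /top divfK// gt_eqF// subr_gt0 b1. Qed.

Lemma res0P x r : r \in residuals 0 x -> r = x /\ inI x.
Proof. by rewrite /=; case: ifP => // _; rewrite inE => /eqP. Qed.

Lemma resSP n x r :
  reflect (exists2 d, (d < m)%N & r \in residuals n (beta * x - d%:R)) (r \in residuals n.+1 x).
Proof.
apply: (iffP flattenP) => [[s /mapP[d]]|[d dm rd]].
  by rewrite mem_iota add0n => dm -> rd; exists d.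
by exists (residuals n (beta * x - d%:R)) => //; apply/mapP; exists d; rewrite // mem_iota.
Qed.

Lemma res_in n x r : r \in residuals n x -> inI r.
Proof.
elim: n x => [|n IH] x; first by move=> /res0P[->].
by move=> /resSP[d _]; exact: IH.
Qed.

Lemma inI_digit x d : (d < m)%N -> inI (beta * x - d%:R) -> inI x.
Proof.
rewrite /inI => dm /andP[h1 h2]; have d0 : 0 <= d%:R :> R by [].
have dm' : d%:R <= m%:R - 1 :> R.
  by rewrite lerBrDr natr1 ler_nat.
have := topE; move: b1 => b1' tE; apply/andP; split; nra.
Qed.

Lemma res_inI n x r : r \in residuals n x -> inI x.
Proof.
elim: n x => [|n IH] x; first by move=> /res0P[].
by move=> /resSP[d dm] /IH; exact: inI_digit.
Qed.

Lemma res_notin n x : ~~ inI x -> residuals n x = [::].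
Proof.
move=> nx; case E: (residuals n x) => [//|r s].
by move: nx; rewrite (@res_inI n x r)// E mem_head.
Qed.

Lemma res_add n k x : residuals (n + k) x = flatten [seq residuals k r | r <- residuals n x].
Proof.
elim: n x => [|n IH] x /=.
  by case: ifP => [|/negbT /res_notin->//] /=; rewrite cats0.
rewrite map_flatten -map_comp; elim: (iota 0 m) => //= d s IHs.
by rewrite flatten_cat IH IHs.
Qed.

Lemma mem_res_add n k x r q :
  r \in residuals n x -> q \in residuals k r -> q \in residuals (n + k) x.
Proof.
move=> rx qr; rewrite res_add; apply/flattenP; exists (residuals k r) => //.
by apply/mapP; exists r.
Qed.

Lemma res_addP n k x q :
  reflect (exists2 r, r \in residuals n x & q \in residuals k r) (q \in residuals (n + k) x).
Proof.
apply: (iffP idP) => [|[r]]; last exact: mem_res_add.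
by rewrite res_add => /flattenP[s /mapP[r rx ->] qr]; exists r.
Qed.

(** The images of the interval under the digit maps overlap since
    [1 < top], which is where the strict inequality [beta < m] matters. *)
Lemma inI_step x : inI x -> exists2 d, (d < m)%N & inI (beta * x - d%:R).
Proof.
move=> /andP[x0 xt]; have b0 : 0 < beta by rewrite (lt_trans ltr01 b1).
have m0 : (0 < m)%N by rewrite -(ltr_nat R) (lt_trans b0 bm).
have bx : 0 < beta * x by rewrite mulr_gt0.
have tE := topE; have t1 := top_gt1.
(* The largest digit that keeps the residual positive. *)
have [d dm dlt] : exists2 d, (d < m)%N &
    (d%:R < beta * x) && ((d.+1 == m) || (beta * x <= d.+1%:R)).
  have E : exists d, (d.+1 == m) || (beta * x <= d.+1%:R).
    by exists m.-1; rewrite prednK// eqxx.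
  case: (ex_minnP E) => d dP dmin; exists d.
    have := dmin m.-1; rewrite prednK// eqxx => /(_ isT); lia.
  rewrite dP andbT; case: d {dP} dmin => [//|d] dmin.
  by rewrite ltNge; apply/negP => h; have := dmin d; rewrite h orbT ltnn => /(_ isT).
exists d => //; move: dlt => /andP[h1 h2].
apply/andP; split; first by rewrite subr_gt0.
case/orP: h2 => [/eqP dE|h2].
  have : m%:R = d%:R + 1 :> R by rewrite -dE -natr1.
  move=> mE; move: tE; rewrite mE; nra.
have : beta * x <= d%:R + 1 by rewrite natr1.
by move=> h; lra.
Qed.

Lemma res_ex n x : inI x -> exists r, r \in residuals n x.
Proof.
elim: n x => [|n IH] x Ix; first by exists x; rewrite /= Ix mem_head.
by have [d dm /IH[r rd]] := inI_step Ix; exists r; apply/resSP; exists d.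
Qed.

Lemma size_res_gt0 n x : inI x -> (0 < size (residuals n x))%N.
Proof. by move=> /(res_ex n)[r]; case: (residuals n x). Qed.

(** The digits that lead from [x] to [r] lead from [x + e] to
    [r + beta^n e]. *)
Lemma res_shift n x r e :
  r \in residuals n x -> inI (r + beta ^+ n * e) -> r + beta ^+ n * e \in residuals n (x + e).
Proof.
elim: n x e => [|n IH] x e.
  by move=> /res0P[-> _]; rewrite expr0 mul1r /= => ->; rewrite mem_head.
move=> /resSP[d dm rd]; rewrite exprSr -mulrA => Ir; apply/resSP; exists d => //.
by rewrite mulrDr addrAC; apply: IH.
Qed.

(** The same shift, counted with multiplicity. *)
Lemma size_res_shift n x e :
  (forall r, r \in residuals n x -> inI (r + beta ^+ n * e)) ->
  (size (residuals n x) <= size (residuals n (x + e)))%N.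
Proof.
elim: n x e => [|n IH] x e H.
  case Ix: (inI x); last by rewrite /= Ix.
  have : inI (x + beta ^+ 0 * e) by apply: H; rewrite /= Ix mem_head.
  by rewrite expr0 mul1r /= => ->; rewrite Ix.
rewrite /= !size_flatten /shape -!map_comp !sumnE !big_map.
rewrite big_seq [X in (_ <= X)%N]big_seq; apply: leq_sum => d; rewrite mem_iota add0n => dm.
rewrite /= mulrDr addrAC; apply: IH => r rd.
by rewrite mulrA -exprSr; apply: H; apply/resSP; exists d.
Qed.

Lemma size_res_add n k x :
  size (residuals (n + k) x) = (\sum_(r <- residuals n x) size (residuals k r))%N.
Proof. by rewrite res_add size_flatten /shape -map_comp sumnE big_map. Qed.

Lemma size_res_le n x : (size (residuals n x) <= m ^ n)%N.
Proof.
elim: n x => [|n IH] x; first by rewrite /=; case: ifP.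
rewrite /= size_flatten /shape -map_comp sumnE big_map.
apply: leq_trans (leq_sum _ (fun i _ => IH _)) _.
by rewrite big_const_seq count_predT size_iota iter_addn_0 expnS mulnC.
Qed.

Lemma size_res_mono n k x : (size (residuals n x) <= size (residuals (n + k) x))%N.
Proof.
rewrite size_res_add -sum1_size big_seq [X in (_ <= X)%N]big_seq.
by apply: leq_sum => r /res_in; exact: size_res_gt0.
Qed.

Lemma beta_gt0 : 0 < beta. Proof. by rewrite (lt_trans ltr01 b1). Qed.

Lemma expb_gt0 n : 0 < beta ^+ n. Proof. by rewrite exprn_gt0// beta_gt0. Qed.

Lemma bapp_comp a b y : bapp (bcomp a b) y = bapp a (bapp b y).
Proof. by rewrite /bapp /bcomp /= exprD invfM; ring. Qed.

Lemma is_branch0 : is_branch (0%N, 0).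
Proof. by move=> y Iy; rewrite /bapp/= expr0 invr1 mul1r addr0 Iy mem_head. Qed.

Lemma is_branch_comp a b : is_branch a -> is_branch b -> is_branch (bcomp a b).
Proof.
move=> ba bb y Iy; rewrite bapp_comp; apply: mem_res_add (bb _ Iy).
by apply: ba; apply: (res_inI (bb _ Iy)).
Qed.

(** Every occurrence of a residual spreads to a branch defined on the whole
    interval, by [res_shift]. *)
Lemma branch_at n x r : r \in residuals n x -> is_branch (n, x - beta ^- n * r).
Proof.
move=> rx y Iy; rewrite /bapp /=.
have b0 : beta ^+ n != 0 by rewrite gt_eqF// expb_gt0.
have E : r + beta ^+ n * (beta ^- n * (y - r)) = y by rewrite mulrA divff// mul1r; ring.
have := @res_shift n x r (beta ^- n * (y - r)) rx.
rewrite E => /(_ Iy); congr (_ \in residuals _ _); ring.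
Qed.

Lemma expbV_small (e : R) : 0 < e -> exists n, beta ^- n < e.
Proof.
move=> e0; have : (fun n => beta^-1 ^+ n) @ \oo --> (0 : R).
  by apply: cvg_expr; rewrite gtr0_norm ?invr_gt0 ?beta_gt0// invf_lt1 ?beta_gt0// b1.
move=> /cvgr0Pnorm_lt /(_ _ e0)[n _ /(_ n (leqnn n))].
by rewrite /= ger0_norm ?exprVn ?invr_ge0 ?ltW ?expb_gt0//; exists n.
Qed.

(** Take the midpoint and the least [n] for which the image of the whole
    interval is shorter than half of ]a, b[; minimality bounds [beta^-n] from
    below. *)
Lemma fill_branch a b : 0 <= a -> a < b -> b <= top ->
  exists v : nat * R, [/\ is_branch v, (0 < v.1)%N,
    forall y, 0 <= y <= top -> a < bapp v y < b
    & (b - a) / (2 * beta * top) <= beta ^- v.1].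
Proof.
move=> a0 ab bt; have tt := top_gt1.
have t0 : 0 < top by lra.
pose x := (a + b) / 2.
have Ix : inI x by rewrite /inI /x; apply/andP; split; lra.
have E : exists n, beta ^- n * top < (b - a) / 2.
  have [|n hn] := @expbV_small ((b - a) / 2 / top); first by rewrite divr_gt0//; lra.
  by exists n; rewrite -ltr_pdivlMr.
case: (ex_minnP E) => n hn nmin.
have n0 : (0 < n)%N.
  by case: n hn {nmin} => // h; exfalso; move: h; rewrite expr0 invr1 mul1r => h; lra.
have [r rx] := res_ex n Ix.
exists (n, x - beta ^- n * r); split => //=; first exact: branch_at.
- move=> y /andP[y0 yt]; rewrite /bapp /=.
  have /andP[r0 rt] := res_in rx.
  have bn : 0 < beta ^- n by rewrite invr_gt0 expb_gt0.
  have h1 : beta ^- n * y <= beta ^- n * top by rewrite ler_pM2l.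
  have h2 : beta ^- n * r < beta ^- n * top by rewrite ltr_pM2l.
  have h3 : 0 <= beta ^- n * y by rewrite mulr_ge0// ltW.
  have h4 : 0 < beta ^- n * r by rewrite mulr_gt0.
  move: h1 h2 h3 h4 hn; rewrite /x.
  move: (beta ^- n * y) (beta ^- n * r) (beta ^- n * top) => p q s *.
  by apply/andP; split; lra.
- rewrite leNgt; apply/negP => h.
  have := nmin n.-1; rewrite leqNgt ltn_predL n0 /= => /contraFF /(_ erefl).
  have -> : beta ^- n.-1 = beta * beta ^- n.
    have b0 : beta != 0 by rewrite gt_eqF// beta_gt0.
    by rewrite -[in RHS](prednK n0) exprS invfM mulrA divff// mul1r.
  move=> /negP/negP; rewrite -leNgt => h'.
  have c0 : 0 < 2 * beta * top by rewrite mulr_gt0// mulr_gt0// beta_gt0.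
  by move: h; rewrite ltr_pdivlMr//; move: h'; lra.
Qed.

End Residuals.

(** * Garsia's lemma *)

Section Garsia.
Context (R : realType).

Lemma map_ratr_intr (K : numFieldType) (p : {poly int}) :
  map_poly (ratr : rat -> K) (map_poly intr p) = map_poly intr p.
Proof. by rewrite -map_poly_comp; apply: eq_map_poly => x /=; rewrite ratr_int. Qed.

(** A rational polynomial of least degree vanishing at [beta] is irreducible
    and divides the given monic integral one; by Gauss's lemma its primitive
    integral multiple has a leading coefficient that divides 1. *)
Lemma integral_min_poly (beta : R) : integralOver (intr : int -> R) beta ->
  exists q : {poly int}, [/\ q \is monic,
    irreducible_poly (map_poly intr q : {poly rat}) & root (map_poly intr q) beta].
Proof.
case=> p pm pr.
pose P n := `[< exists q : {poly rat},
  [/\ size q = n, q != 0 & root (map_poly ratr q) beta] >].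
have exP : exists n, P n.
  exists (size (map_poly intr p : {poly rat})); apply/asboolP.
  exists (map_poly intr p); split => //.
    by rewrite monic_neq0// monic_map.
  by rewrite map_ratr_intr.
case: (ex_minnP exP) => n /asboolP[q [sq q0 qr]] nmin.
have qmin (q' : {poly rat}) :
    q' != 0 -> root (map_poly ratr q') beta -> (size q <= size q')%N.
  by move=> q'0 q'r; rewrite sq; apply: nmin; apply/asboolP; exists q'.
have qdiv (q' : {poly rat}) : root (map_poly ratr q') beta -> q %| q'.
  move=> q'r; rewrite /dvdp; apply/negPn/negP => r0.
  have := qmin _ r0; rewrite leqNgt ltn_modp q0 => /(_ _)/negP; apply; last by [].
  have : root (map_poly ratr (q' %/ q * q + q' %% q)) beta by rewrite -divp_eq.
  by rewrite rmorphD rmorphM /= /root hornerD hornerM (eqP qr) mulr0 add0r.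
have sq1 : (1 < size q)%N.
  rewrite ltnNge; apply/negP => /size1_polyC qC.
  move: qr q0; rewrite qC map_polyC /root hornerC/= fmorph_eq0 => /eqP ->.
  by rewrite eqxx.
have qirr : irreducible_poly q.
  split => // d d1 /dvdpP[e qE].
  have : root (map_poly ratr (e * d)) beta by rewrite -qE.
  have [e0 d0] : e != 0 /\ d != 0.
    by move: q0; rewrite qE mulf_eq0 negb_or => /andP[].
  rewrite rmorphM /= rootM => /orP[er|dr].
    have := qmin _ e0 er; rewrite qE size_mul// leqNgt => /negP[].
    move: d1 d0 e0; rewrite -!size_poly_gt0.
    by move: (size d) (size e) => k l /eqP; lia.
  rewrite /eqp qdiv// andbT; apply/dvdpP; exists e; exact: qE.
have /qdiv : root (map_poly ratr (map_poly intr p : {poly rat})) beta.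
  by rewrite map_ratr_intr.
move=> /dvdpP_rat_int[p1 [a a0 qE] [r pE]].
have [s [s0 sm]] : exists s : int, s != 0 /\ s *: p1 \is monic.
  exists (lead_coef r); rewrite monicE lead_coefZ.
  have E : lead_coef r * lead_coef p1 = 1.
    by rewrite -(monicP pm) pE lead_coefM mulrC.
  by split; [apply: contra_eq_neq E => /= ->; rewrite mul0r | apply/eqP].
exists (s *: p1); split => //.
  have E : map_poly intr (s *: p1) = (s%:~R / a) *: q :> {poly rat}.
    by rewrite qE scalerA divfK// map_polyZ.
  have c0 : s%:~R / a != 0 by rewrite mulf_neq0 ?invr_eq0// intr_eq0.
  rewrite E; split; first by rewrite size_scale.
  by move=> d d1; rewrite dvdpZr// (eqp_rtrans (eqp_scale _ c0)); apply: qirr.2.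
move: qr; rewrite qE map_polyZ /= rootZ ?fmorph_eq0// map_ratr_intr.
by rewrite map_polyZ /= rootZ// intr_eq0.
Qed.

Lemma irredp_separable (q : {poly rat}) : irreducible_poly q -> separable_poly q.
Proof.
move=> [sq qirr]; rewrite unlock /coprimep; apply/negPn/negP => g1.
have /eqp_dvdl E := qirr _ g1 (dvdp_gcdl _ _).
have qd : q %| q^`() by rewrite -E dvdp_gcdr.
have q0 : q != 0 by rewrite -size_poly_gt0 ltnW.
have d0 : q^`() != 0.
  apply/eqP => /(congr1 (fun p : {poly rat} => p`_(size q).-2)).
  have s2 : (size q).-2.+1 = (size q).-1 by move: sq; case: (size q) => [|[]].
  rewrite coef_deriv coef0 s2 => /eqP.
  rewrite mulrn_eq0 -lead_coefE lead_coef_eq0 (negbTE q0) orbF => /eqP s1.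
  by move: sq s1; case: (size q) => [|[]].
by have := dvdp_leq d0 qd; rewrite leqNgt lt_size_deriv.
Qed.

Lemma pisot_roots (beta : R) : Pisot beta ->
  exists (q : {poly int}) (rs : seq R[i]), [/\ q \is monic, uniq rs,
    map_poly intr q = \prod_(z <- rs) ('X - z%:P) :> {poly R[i]},
    (beta%:C)%C \in rs & forall z, z \in rs -> z != (beta%:C)%C -> `|z| < 1].
Proof.
case=> /integral_min_poly[q [qm qi qr]] b1 conj.
have [rs rsE] := closed_field_poly_normal (map_poly intr q : {poly R[i]}).
have mm : (map_poly intr q : {poly R[i]}) \is monic by rewrite monic_map.
rewrite (monicP mm) scale1r in rsE.
have rootE z : (z \in rs) = root (map_poly intr q : {poly R[i]}) z.
  by rewrite rsE root_prod_XsubC.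
have bC : root (map_poly intr q : {poly R[i]}) (beta%:C)%C.
  rewrite -(fmorph_root (real_complex R)) -map_poly_comp in qr.
  by move: qr; congr root; apply: eq_map_poly => x /=; rewrite rmorph_int.
exists q, rs; split => //.
- rewrite -separable_prod_XsubC -rsE -(@map_ratr_intr R[i]) separable_map.
  exact: irredp_separable.
- by rewrite rootE.
move=> z; rewrite rootE => zr zb; apply: conj => //.
by exists (map_poly intr q); rewrite !map_ratr_intr.
Qed.

(** Compare with the geometric series of ratio [|z|]. *)
Lemma horner_bounded (z : R[i]) (B : nat) (P : {poly int}) : `|z| < 1 ->
  (forall k, `|P`_k| <= B%:Z) -> `|(map_poly intr P).[z]| <= B%:R / (1 - `|z|).
Proof.
move=> z1 PB; rewrite ler_pdivlMr ?subr_gt0// horner_coef.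
set n := size _.
have : `|\sum_(i < n) (map_poly intr P)`_i * z ^+ i| <= B%:R * \sum_(i < n) `|z| ^+ i.
  apply: le_trans (ler_norm_sum _ _ _) _; rewrite mulr_sumr; apply: ler_sum => i _.
  rewrite normrM normrX ler_wpM2r ?exprn_ge0//.
  by rewrite coef_map /= -intr_norm -[B%:R]/((B%:Z)%:~R) ler_int.
have z1' : 0 <= 1 - `|z| by rewrite subr_ge0 ltW.
move=> /(ler_wpM2r z1') h; apply: le_trans h _.
rewrite -mulrA [X in _ * X]mulrC -opprB mulNr -subrX1 opprB.
by rewrite ler_piMr// lerBlDr lerDl exprn_ge0.
Qed.

(** Modulo the minimal polynomial [P] is determined by integers [c_j], one for
    each power of [beta] below the degree. The values of [P] at all the
    conjugates are bounded: at [beta] by hypothesis, at the others by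
    [horner_bounded]. As the conjugates are distinct, inverting their Vandermonde
    matrix bounds the [c_j], which leaves finitely many values. *)
Lemma garsia (beta : R) (B : nat) (T : R) : Pisot beta ->
  exists V : seq R, forall P : {poly int}, (forall k, `|P`_k| <= B%:Z) ->
    `|(map_poly intr P).[beta]| <= T -> (map_poly intr P).[beta] \in V.
Proof.
move=> /pisot_roots[q [rs [qm urs qE brs rs1]]].
have hC (P : {poly int}) :
    ((map_poly intr P).[beta]%:C)%C = (map_poly intr P).[(beta%:C)%C].
  rewrite -horner_map /= -map_poly_comp; congr (_.[_]).
  by apply: eq_map_poly => x /=; rewrite rmorph_int.
set d := size rs.
have sq : size q = d.+1.
  have := congr1 (fun p : {poly R[i]} => size p) qE.
  by rewrite size_prod_XsubC size_map_inj_poly//; exact: intr_inj.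
(* A common bound for the values at all the conjugates. *)
pose K z : R[i] := if z == (beta%:C)%C then (`|T|%:C)%C else B%:R / (1 - `|z|).
pose Kt : R[i] := \sum_(z <- rs) `|K z|.
have Kt0 : 0 <= Kt by rewrite sumr_ge0.
have PK (P : {poly int}) z : (forall k, `|P`_k| <= B%:Z) ->
    `|(map_poly intr P).[beta]| <= T -> z \in rs -> `|(map_poly intr P).[z]| <= Kt.
  move=> PB PT zrs; apply: (@le_trans _ _ (K z)).
    rewrite /K; case: eqVneq => [->|zb]; last by apply: horner_bounded => //; apply: rs1.
    rewrite -hC normc_def /= expr0n addr0 sqrtr_sqr lecR.
    exact: le_trans PT (ler_norm _).
  have K0 : 0 <= K z.
    rewrite /K; case: eqVneq => [_|zb]; first by rewrite lecR.
    by rewrite divr_ge0// subr_ge0 ltW// rs1.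
  rewrite -[K z]ger0_norm//.
  by rewrite /Kt (big_rem z)//= lerDl sumr_ge0.
pose zr : 'rV[R[i]]_d := \row_j rs`_j.
pose W := Vandermonde d zr.
have Wu : W \in unitmx.
  rewrite unitmxE unitfE det_Vandermonde; apply/prodf_neq0 => i _.
  apply/prodf_neq0 => j ij; rewrite !mxE subr_eq0 nth_uniq// ?ltn_ord//.
  by rewrite gt_eqF.
pose Kc : R[i] := \sum_j \sum_i Kt * `|invmx W j i|.
(* A natural bound for the coordinates in the basis of powers of beta. *)
have [N NK] : exists N : nat, Kc <= N%:R.
  have Kc0 : 0 <= Kc by do 2!rewrite sumr_ge0// => ? _; rewrite mulr_ge0.
  exists (Num.bound (complex.Re Kc)).
  rewrite -(RRe_real (ger0_real Kc0)) -(rmorph_nat (real_complex R)) lecR.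
  by rewrite ltW// archi_boundP//; move: Kc0; rewrite lecE => /andP[].
exists [seq \sum_(i < d) ((f i)%:Z - N%:Z)%:~R * beta ^+ i
  | f : {ffun 'I_d -> 'I_(2 * N).+1}].
move=> P PB PT.
pose c := Pdiv.Ring.rmodp P q.
have PE : P = Pdiv.Ring.rdivp P q * q + c by apply: Pdiv.RingMonic.rdivp_eq.
have sc : (size c <= d)%N by rewrite -ltnS -sq Pdiv.Ring.ltn_rmodp monic_neq0.
have cz z : z \in rs -> (map_poly intr c).[z] = (map_poly intr P).[z].
  move=> zrs; rewrite [in RHS]PE rmorphD rmorphM /= hornerD hornerM qE.
  have /eqP -> : root (\prod_(z0 <- rs) ('X - z0%:P)) z by rewrite root_prod_XsubC.
  by rewrite mulr0 add0r.
have cb : (map_poly intr c).[beta] = (map_poly intr P).[beta].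
  by apply: (@complexI R); rewrite !hC cz.
pose cr : 'rV[R[i]]_d := \row_i (c`_i)%:~R.
have crE : cr = (\row_j (map_poly intr P).[rs`_j]) *m invmx W.
  rewrite -[cr](mulmxK Wu); congr (_ *m _); apply/rowP => j; rewrite !mxE.
  rewrite -cz ?mem_nth// (@horner_coef_wide _ d); last first.
    by apply: leq_trans (size_poly _ _) sc.
  by apply: eq_bigr => i _; rewrite !mxE coef_map.
have cN (i : 'I_d) : `|c`_i| <= N%:Z.
  rewrite -(@ler_int R[i]) intr_norm; apply: le_trans NK.
  have -> : (c`_i)%:~R = cr 0 i by rewrite mxE.
  rewrite crE mxE; apply: le_trans (ler_norm_sum _ _ _) _; apply: ler_sum => j _.
  rewrite (bigD1 i)//= normrM mxE; apply: le_trans (_ : Kt * `|invmx W j i| <= _).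
    by rewrite ler_wpM2r// PK// mem_nth.
  by rewrite lerDl sumr_ge0// => ? _; rewrite mulr_ge0.
have ci (i : 'I_d) : (absz (c`_i + N%:Z)%R < (2 * N).+1)%N by have := cN i; lia.
apply/mapP; exists [ffun i => Ordinal (ci i)]; first by rewrite mem_enum.
rewrite -cb (@horner_coef_wide _ d) ?(leq_trans (size_poly _ _))//.
apply: eq_bigr => i _; rewrite coef_map ffunE /=; congr (_%:~R * _).
have := cN i; move: (c`_i) => z. lia.
Qed.

(** The coefficients of [P] are the differences of the digits used on the two
    sides, whence their bound. *)
Lemma res_diff (beta : R) m n x x' r r' :
  r \in residuals beta m n x -> r' \in residuals beta m n x' ->
  exists P : {poly int}, [/\ (size P <= n)%N, forall k, `|P`_k| <= m%:Z
    & r' - r = beta ^+ n * (x' - x) + (map_poly intr P).[beta]].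
Proof.
elim: n x x' => [|n IH] x x'.
  move=> /res0P[-> _] /res0P[-> _]; exists 0; split; rewrite ?size_poly0//.
    by move=> k; rewrite coef0.
  by rewrite map_poly0 horner0 expr0 mul1r addr0.
move=> /resSP[d dm rd] /resSP[d' dm' rd'].
have [P [sP PB PE]] := IH _ _ rd rd'.
exists (P + (d%:Z - d'%:Z)%:P * 'X^n); split.
- apply: leq_trans (size_polyD _ _) _; rewrite geq_max (leq_trans sP)//=.
  rewrite mul_polyC (leq_trans (size_scale_leq _ _))// size_polyXn//.
- move=> k; rewrite coefD coefCM coefXn; case: eqVneq => [->|_].
    by rewrite nth_default// mulr1 add0r; lia.
  by rewrite mulr0 addr0.
rewrite PE rmorphD rmorphM /= map_polyC map_polyXn hornerD hornerM hornerC hornerXn /=.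
by rewrite rmorphB /= -!pmulrn exprS; ring.
Qed.

Lemma res_diff_finite (beta : R) m : Pisot beta ->
  exists V : seq R, forall x n r r',
    r \in residuals beta m n x -> r' \in residuals beta m n x -> r' - r \in V.
Proof.
move=> hP; have [V VP] := garsia m (top beta m) hP; exists V => x n r r' rx r'x.
have [P [_ PB]] := res_diff rx r'x.
rewrite subrr mulr0 add0r => E; rewrite E; apply: VP => //; rewrite -E.
have := res_in rx; have := res_in r'x; rewrite /inI => /andP[? ?] /andP[? ?].
by rewrite ler_norml; apply/andP; split; lra.
Qed.

End Garsia.

(** * An interval on which all pasts merge *)

Section Pattern.
Context (R : realType) (beta : R) (m : nat).
Context {hb : expanding beta m}.
Local Notation b1 := (@base_gt1 _ _ _ hb).
Local Notation bm := (@base_lt _ _ _ hb).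
Local Notation residuals := (@residuals R beta m).
Local Notation inI := (@inI R beta m).
Local Notation top := (top beta m).

(** The past of [z] is forgotten after [t] steps: what it reaches is reached
    from [z] alone. The reverse inclusion always holds. *)
Definition merging t z := forall x n,
  z \in residuals n x -> {subset residuals (n + t) x <= residuals t z}.

Lemma merging_mono t k z : merging t z -> merging (t + k) z.
Proof.
move=> h x n zx q; rewrite addnA => /res_addP[r /(h _ _ zx)].
exact: mem_res_add.
Qed.

Lemma merging_back t k z y : y \in residuals k z -> merging t y -> merging (k + t) z.
Proof.
move=> yz h x n zx q; rewrite addnA => /(h _ _ (mem_res_add zx yz)).
exact: mem_res_add.
Qed.

Lemma inI_open (s : seq R) : all inI s ->
  exists2 d : R, 0 < d & forall e r : R, `|e| < d -> r \in s -> inI (r + e).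
Proof.
elim: s => [|x s IH] /=; first by exists 1.
move=> /andP[/andP[x0 x1] /IH[d d0 dP]].
exists (Num.min d (Num.min x (top - x))).
  by rewrite !lt_min d0 x0 subr_gt0.
move=> e r; rewrite !lt_min => /and3P[h1 h2 h3].
rewrite inE => /orP[/eqP ->|]; last exact: dP.
move: h2 h3; rewrite !ltr_norml => /andP[? ?] /andP[? ?].
by rewrite /inI; apply/andP; split; lra.
Qed.

Lemma res_open n x : exists2 d : R, 0 < d &
  forall e r : R, `|e| < d -> r \in residuals n x -> inI (r + beta ^+ n * e).
Proof.
have [|d d0 dP] := @inI_open (residuals n x); first by apply/allP => r /res_in.
exists (d / beta ^+ n); first by rewrite divr_gt0// expb_gt0.
move=> e r; rewrite ltr_pdivlMr ?expb_gt0// => h rx; apply: dP => //.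
by rewrite normrM [`|beta ^+ n|]gtr0_norm ?expb_gt0// mulrC.
Qed.

Lemma res_open_itv n x : inI x -> exists p q : R, [/\ 0 <= p, p < q, q <= top &
  forall y, p < y < q -> forall r, r \in residuals n x -> inI (r + beta ^+ n * (y - x))].
Proof.
move=> /andP[x0 x1]; have [d d0 dP] := res_open n x.
exists (Num.max 0 (x - d)), (Num.min top (x + d)); split.
- by rewrite le_max lexx.
- by rewrite gt_max !lt_min; apply/andP; split; apply/andP; split; lra.
- by rewrite ge_min lexx.
- move=> y; rewrite gt_max lt_min => /andP[/andP[_ h1] /andP[_ h2]] r.
  by apply: dP; rewrite ltr_norml; apply/andP; split; lra.
Qed.

Lemma fill_near (r d y : R) : inI r -> 0 < d -> inI y ->
  exists2 v, is_branch beta m v & `|bapp beta v y - r| < d.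
Proof.
move=> /andP[r0 r1] d0 /andP[y0 y1].
have [|||v [vb _ vP _]] := @fill_branch R beta m hb (Num.max 0 (r - d)) (Num.min top (r + d)).
- by rewrite le_max lexx.
- by rewrite gt_max !lt_min !(lt_trans r0 r1)/=; apply/and3P; split; lra.
- by rewrite ge_min lexx.
exists v => //; have := vP y; rewrite !ltW// => /(_ isT).
by rewrite gt_max lt_min ltr_norml => /andP[/andP[_ ?] /andP[_ ?]]; apply/andP; split; lra.
Qed.

(** A point of the overlap of the first two digit maps, which exists as [1 < top]. *)
Lemma two_residuals : exists2 z, inI z & (2 <= size (residuals 1 z))%N.
Proof.
have t1 : 1 < top by exact: top_gt1.
have b0 : 0 < beta := @beta_gt0 _ _ _ hb.
have m2 : (2 <= m)%N by rewrite -(ltr_nat R); exact: lt_trans b1 bm.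
have iotaE : iota 0 m = [:: 0, 1 & iota 2 (m - 2)]%N.
  by move: m2; case: (m) => [|[|k]]//= _; rewrite !subSS subn0.
have E : beta * ((1 + top) / 2 / beta) = (1 + top) / 2.
  by rewrite mulrC divfK// gt_eqF.
have I0 : inI (beta * ((1 + top) / 2 / beta) - 0%:R).
  by rewrite E /inI; apply/andP; split; lra.
have I1 : inI (beta * ((1 + top) / 2 / beta) - 1%:R).
  by rewrite E /inI; apply/andP; split; lra.
exists ((1 + top) / 2 / beta); first by apply: inI_digit I0; apply: ltnW.
by rewrite /= iotaE /= I0 I1.
Qed.

(** Move the point slightly so that one of its residuals lands on a point
    with two residuals, by means of a branch; the other residuals survive. *)
Lemma large_count B : exists x n, inI x /\ (B < size (residuals n x))%N.
Proof.
elim: B => [|B [x [n [Ix Bx]]]].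
  have [z Iz _] := two_residuals.
  by exists z, 0%N; split => //; rewrite size_res_gt0.
have [d d0 dP] := res_open n x.
have [r rx] := res_ex n Ix.
have [z Iz z2] := two_residuals.
have bn : 0 < beta ^+ n by exact: expb_gt0.
have [|v vb vr] := @fill_near r (d * beta ^+ n) z (res_in rx) _ Iz.
  by rewrite mulr_gt0.
set r' := bapp beta v z in vr.
(* The shift of the point that moves its residual r to r'. *)
pose e := (r' - r) / beta ^+ n.
have ed : `|e| < d.
  by rewrite normrM normfV [`|beta ^+ n|]gtr0_norm// ltr_pdivrMr.
have r'E : r' = r + beta ^+ n * e by rewrite /e mulrC divfK ?gt_eqF//; ring.
have r'x : r' \in residuals n (x + e) by rewrite r'E; apply: res_shift => //; apply: dP.
have sx : (B < size (residuals n (x + e)))%N.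
  by apply: leq_trans Bx _; apply: size_res_shift => q qx; apply: dP.
exists (x + e), (n + (v.1 + 1))%N; split; first exact: res_inI r'x.
rewrite size_res_add (big_rem r')//=.
have h2 : (2 <= size (residuals (v.1 + 1) r'))%N.
  rewrite size_res_add (big_rem z) ?vb//=.
  by apply: leq_trans z2 _; rewrite leq_addr.
have h1 : (size (rem r' (residuals n (x + e))) <=
           \sum_(y <- rem r' (residuals n (x + e))) size (residuals (v.1 + 1) y))%N.
  rewrite -sum1_size big_seq [X in (_ <= X)%N]big_seq; apply: leq_sum => y /mem_rem /res_in.
  exact: size_res_gt0.
rewrite size_rem// in h1; apply: leq_trans (leq_add h2 h1).
by move: sx; case: (size _) => // k; rewrite ltnS add2n.
Qed.

Lemma image_itv v a b y : bapp beta v a < y < bapp beta v b ->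
  exists2 z, a < z < b & y = bapp beta v z.
Proof.
rewrite /bapp => /andP[h1 h2]; have bn : 0 < beta ^+ v.1 by exact: expb_gt0.
have bn' : 0 < beta ^- v.1 by rewrite invr_gt0.
have E : y = beta ^- v.1 * (beta ^+ v.1 * (y - v.2)) + v.2.
  by rewrite mulKf ?gt_eqF//; ring.
exists (beta ^+ v.1 * (y - v.2)) => //.
by move: h1 h2; rewrite {1 2}E !ltrD2r !ltr_pM2l// => -> ->.
Qed.

Lemma bapp_lt v a b : a < b -> bapp beta v a < bapp beta v b.
Proof. by move=> ab; rewrite ltrD2r ltr_pM2l// invr_gt0 expb_gt0. Qed.

Lemma large_count_itv B a b : 0 <= a -> a < b -> b <= top ->
  exists a' b' i, [/\ a <= a', a' < b', b' <= b &
    forall y, a' < y < b' -> (B <= size (residuals i y))%N].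
Proof.
move=> a0 ab bt; have [v [vb _ vP _]] := fill_branch a0 ab bt.
have [x [n [Ix Bx]]] := large_count B.
have [p [q [p0 pq qt pqP]]] := res_open_itv n Ix; have /andP[x0 x1] := Ix.
exists (bapp beta v p), (bapp beta v q), (v.1 + n)%N.
have h1 : 0 <= p <= top by apply/andP; split; lra.
have h2 : 0 <= q <= top by apply/andP; split; lra.
have /andP[/ltW ? _] := vP _ h1; have /andP[_ /ltW ?] := vP _ h2.
split => //; first exact: bapp_lt.
move=> y /image_itv[z /andP[z1 z2] ->].
have zn : (B < size (residuals n z))%N.
  apply: leq_trans Bx _; have -> : z = x + (z - x) by ring.
  by apply: size_res_shift => r rx; apply: pqP => //; rewrite z1.
have Iz : inI z by rewrite /inI; apply/andP; split; lra.
by rewrite size_res_add (big_rem z) ?vb//=; apply: leq_trans (leq_addr _ _); apply: ltnW.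
Qed.

Context (V : seq R).
Hypothesis hV : forall x n r r', r \in residuals n x -> r' \in residuals n x -> r' - r \in V.

Lemma size_undup_res n x : (size (undup (residuals n x)) <= size V)%N.
Proof.
case E: (residuals n x) => [//|r s]; rewrite -E.
rewrite -(size_map (fun y => y - r)); apply: uniq_leq_size.
  by rewrite map_inj_uniq ?undup_uniq//; exact: addIr.
move=> _ /mapP[r' r'x ->]; rewrite mem_undup in r'x.
by apply: (hV _ r'x); rewrite E mem_head.
Qed.

(** The descendants of [z] are among those of its past, and the latter are
    not more numerous. *)
Lemma merging_of_max t z :
  (forall x n, size (undup (residuals n x)) <= size (undup (residuals t z)))%N -> merging t z.
Proof.
move=> h x n zx q.
have sub : {subset undup (residuals t z) <= undup (residuals (n + t) x)}.
  by move=> y; rewrite !mem_undup; exact: mem_res_add.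
have [_ E] := uniq_min_size (undup_uniq _) sub (h _ _).
by rewrite -mem_undup -E mem_undup.
Qed.

(** A maximal number of distinct residuals exists by [size_undup_res], and is
    attained on an open interval by [res_shift]. *)
Lemma merging_itv : exists a b t, [/\ 0 <= a, a < b, b <= top &
  forall y, a < y < b -> merging t y].
Proof.
pose P k := `[< exists x n, size (undup (residuals n x)) = k >].
have exP : exists k, P k by exists (size (undup (residuals 0 0))); apply/asboolP; exists 0, 0%N.
have ub k : P k -> (k <= size V)%N.
  by move=> /asboolP[x [n <-]]; exact: size_undup_res.
case: (ex_maxnP exP ub) => D /asboolP[x [n DE]] Dmax.
have D0 : (0 < D)%N.
  have [z Iz _] := two_residuals.
  by apply: Dmax; apply/asboolP; exists z, 0%N; rewrite /= Iz.
have Ix : inI x.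
  by apply/negPn/negP => /res_notin E; move: D0; rewrite -DE E.
have [p [q [p0 pq qt pqP]]] := res_open_itv n Ix.
exists p, q, n; split => // y ypq; apply: merging_of_max => x' n'.
apply: (@leq_trans D); first by apply: Dmax; apply/asboolP; exists x', n'.
rewrite -DE -(size_map (fun r => r + beta ^+ n * (y - x))); apply: uniq_leq_size.
  by rewrite map_inj_uniq ?undup_uniq//; exact: addIr.
move=> q0 /mapP[r]; rewrite mem_undup => rx ->; rewrite mem_undup.
have E : y = x + (y - x) by ring.
by rewrite [X in residuals n X]E; apply: res_shift => //; apply: pqP.
Qed.

(** All residuals of a point with a residual in ]a, b[ are translates of that
    one by differences of residuals. This decides, uniformly over ]a, b[, which of
    these translates are residuals, and makes those merging. *)
Definition settled (s : seq R) a b t := forall e, e \in s ->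
  (forall y, a < y < b -> ~~ inI (y + e)) \/
  (forall y, a < y < b -> inI (y + e) /\ merging t (y + e)).

(** If the translate meets the interval, plant in it, with a branch, a copy of
    the interval of [merging_itv]; merging is inherited backwards along branches. *)
Lemma settled_step a b s : 0 <= a -> a < b -> b <= top ->
  exists a' b' t, [/\ a <= a', a' < b', b' <= b &
    (forall y, a' < y < b' -> ~~ inI (y + s)) \/
    (forall y, a' < y < b' -> inI (y + s) /\ merging t (y + s))].
Proof.
move=> a0 ab bt; case: (pselect (exists2 y, a < y < b & inI (y + s))); last first.
  move=> h; exists a, b, 0%N; split => //; left => y yab.
  by apply/negP => Iy; apply: h; exists y.
case=> y /andP[ay yb] /andP[y0 y1].
have [p [q [t [p0 pq qt pqt]]]] := merging_itv.
have [|||v [vb _ vP _]] := @fill_branch _ beta m _ (Num.max 0 (a + s)) (Num.min top (b + s)).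
- by rewrite le_max lexx.
- by rewrite gt_max !lt_min; apply/andP; split; apply/andP; split; lra.
- by rewrite ge_min lexx.
have h1 : 0 <= p <= top by apply/andP; split; lra.
have h2 : 0 <= q <= top by apply/andP; split; lra.
have := vP _ h1; have := vP _ h2.
rewrite !gt_max !lt_min => /and3P[/andP[? ?] ? ?] /and3P[/andP[? ?] ? ?].
exists (bapp beta v p - s), (bapp beta v q - s), (v.1 + t)%N.
split; [by rewrite lerBrDr ltW|by rewrite ltrD2r bapp_lt|by rewrite lerBlDr ltW|].
right => z; rewrite ltrBlDr ltrBrDr => /image_itv[u /andP[u1 u2] ->].
have Iu : inI u by rewrite /inI; apply/andP; split; lra.
split; first exact: res_inI (vb _ Iu).
by apply: merging_back (vb _ Iu) _; apply: pqt; rewrite u1.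
Qed.

Lemma settled_list (s : seq R) a b : 0 <= a -> a < b -> b <= top ->
  exists a' b' t, [/\ a <= a', a' < b', b' <= b & settled s a' b' t].
Proof.
elim: s a b => [|e s IH] a b a0 ab bt; first by exists a, b, 0%N; split.
have [a1 [b2 [t [h1 h2 h3 h4]]]] := IH a b a0 ab bt.
have [||a' [b' [t' [h5 h6 h7 h8]]]] := @settled_step a1 b2 e _ h2; try lra.
exists a', b', (t + t')%N; split; try lra.
move=> e'; rewrite inE => /orP[/eqP ->|/h4[h|h]].
- case: h8 => [h|h]; first by left.
  by right => y /h[? ?]; split => //; rewrite addnC; apply: merging_mono.
- by left => y /andP[y1 y2]; apply: h; apply/andP; split; lra.
- right => y /andP[y1 y2]; have [|? ?] := h y; first by apply/andP; split; lra.
  by split => //; apply: merging_mono.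
Qed.

(** Shrinking the interval does not affect [t], so that the count can be made
    large compared with [m ^ t] afterwards. *)
Lemma good_itv : exists a b t i, [/\ 0 < a, a < b, b < top, settled V a b t &
  forall y, a < y < b -> (2 * m ^ t <= size (residuals i y))%N].
Proof.
have t1 : 1 < top by exact: top_gt1.
(* Starting in the middle third keeps away from the ends of the interval. *)
have [|||a [b [t [h1 h2 h3 h4]]]] := @settled_list V (top / 3) (2 * top / 3); try lra.
have [|||a' [b' [i [h5 h6 h7 h8]]]] := @large_count_itv (2 * m ^ t) a b; try lra.
exists a', b', t, i; split => //; try lra.
move=> s /h4[h|h]; [left|right] => y /andP[y1 y2]; apply: h;
  by apply/andP; split; lra.
Qed.

End Pattern.

(** * Quasi-multiplicativity of the counts *)

Section QuasiMultiplicative.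
Context (R : realType) (beta : R) (m : nat).
Context {hb : expanding beta m}.
Local Notation residuals := (@residuals R beta m).
Local Notation inI := (@inI R beta m).
Local Notation top := (top beta m).

Context (V : seq R).
Hypothesis hV : forall x n r r', r \in residuals n x -> r' \in residuals n x -> r' - r \in V.
Context (a b : R) (t i0 : nat).
Hypotheses (a0 : 0 < a) (ab : a < b) (bt : b < top).
Hypothesis hab : settled beta m V a b t.
Hypothesis large : forall y, a < y < b -> (2 * m ^ t <= size (residuals i0 y))%N.

Lemma leq_sum_in (s : seq R) (f g : R -> nat) : {in s, forall q, f q <= g q}%N ->
  (\sum_(q <- s) f q <= \sum_(q <- s) g q)%N.
Proof. by move=> h; rewrite big_seq [X in (_ <= X)%N]big_seq; apply: leq_sum. Qed.

Lemma sum_undup_le (s : seq R) (f : R -> nat) :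
  (\sum_(q <- undup s) f q <= \sum_(q <- s) f q)%N.
Proof.
elim: s => //= x s IH; case: ifP => _; rewrite !big_cons ?leq_add2l//.
exact: leq_trans IH (leq_addl _ _).
Qed.

(** For [t <= i] each element is hit at most [m ^ t] times at time [t], so the
    counts from [r] and [r'] both agree up to [m ^ t] with the sum over the common
    set of descendants; before that time [m ^ t] is a trivial bound. *)
Lemma same_future r r' i : inI r -> residuals t r =i residuals t r' ->
  (size (residuals i r') <= m ^ t * size (residuals i r))%N.
Proof.
move=> Ir E; have m0 : (0 < m)%N.
  by rewrite -(ltr_nat R); apply: lt_trans (lt_trans ltr01 base_gt1) base_lt.
case: (leqP i t) => [it|/ltnW ti].
  apply: leq_trans (size_res_le _ _ _ _) _; apply: (@leq_trans (m ^ t)).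
    by rewrite leq_pexp2l.
  by rewrite leq_pmulr// size_res_gt0.
rewrite -(subnKC ti) !size_res_add.
set f := fun q => size (residuals (i - t) q).
apply: (@leq_trans (m ^ t * \sum_(q <- undup (residuals t r')) f q)).
  apply: (@leq_trans (\sum_(q <- residuals t r') \sum_(p <- undup (residuals t r')) f p)).
    apply: leq_sum_in => q qr.
    by rewrite [X in (_ <= X)%N](big_rem q) ?mem_undup//= leq_addr.
  by rewrite big_const_seq count_predT iter_addn_0 mulnC leq_mul2r size_res_le orbT.
rewrite leq_mul2l; apply/orP; right.
rewrite (perm_big (undup (residuals t r))) ?sum_undup_le//=.
by apply: uniq_perm; rewrite ?undup_uniq// => q; rewrite !mem_undup E.
Qed.

(** Both residuals differ from [r] by elements of [V], hence are merging:
    their descendants at time [t] are all the descendants of [x]. *)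
Lemma comparable_counts x n r r' i : r \in residuals n x -> a < r < b -> r' \in residuals n x ->
  (size (residuals i r') <= m ^ t * size (residuals i r))%N /\
  (size (residuals i r) <= m ^ t * size (residuals i r'))%N.
Proof.
move=> rx rab r'x.
have fl q : q \in residuals n x -> merging beta m t q.
  move=> qx; have /hab[h|h] := hV rx qx.
    by have := h _ rab; rewrite addrC subrK (res_in qx).
  by have := (h _ rab).2; rewrite addrC subrK.
have E q : q \in residuals n x -> residuals (n + t) x =i residuals t q.
  move=> qx p; apply/idP/idP; [exact: (fl _ qx)|exact: mem_res_add].
split; apply: same_future; rewrite ?(res_in rx) ?(res_in r'x)// => p.
  by rewrite -!E.
by rewrite -!E.
Qed.

(** The count at time [n + i] is a sum over the residuals at time [n] of counts
    that are all comparable with the one from [r]. *)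
Lemma size_res_quasi_mul x n r i : r \in residuals n x -> a < r < b ->
  (size (residuals (n + i) x) <= m ^ t * (size (residuals n x) * size (residuals i r)))%N /\
  (size (residuals n x) * size (residuals i r) <= m ^ t * size (residuals (n + i) x))%N.
Proof.
move=> rx rab; rewrite size_res_add; split.
  apply: (@leq_trans (\sum_(q <- residuals n x) m ^ t * size (residuals i r))).
    apply: leq_sum_in => q qx.
    exact: (comparable_counts _ rx rab qx).1.
  by rewrite big_const_seq count_predT iter_addn_0 mulnAC mulnA.
apply: (@leq_trans (\sum_(q <- residuals n x) size (residuals i r))).
  by rewrite big_const_seq count_predT iter_addn_0 mulnC.
rewrite big_distrr /= big_seq [X in (_ <= X)%N]big_seq; apply: leq_sum => q qx.
exact: (comparable_counts _ rx rab qx).2.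
Qed.

Lemma size_res_double x n r : r \in residuals n x -> a < r < b ->
  (2 * size (residuals n x) <= size (residuals (n + i0) x))%N.
Proof.
move=> rx rab; have [_ h] := size_res_quasi_mul i0 rx rab.
have m0 : (0 < m ^ t)%N.
  by rewrite expn_gt0 -(ltr_nat R) (lt_trans (lt_trans ltr01 base_gt1) base_lt).
rewrite -(leq_pmul2l m0); apply: leq_trans h.
by rewrite mulnCA mulnA mulnC leq_mul2l large ?orbT.
Qed.

(** [settled] fixes the set of translates that stay in the interval, so every
    residual at one point moves to a residual at the other. *)
Lemma size_res_const v y y' : is_branch beta m v -> a < y < b -> a < y' < b ->
  (size (residuals v.1 (bapp beta v y)) <= size (residuals v.1 (bapp beta v y')))%N.
Proof.
move=> vb yab y'ab.
have Iy : inI y.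
  by case/andP: yab => y1 y2; rewrite /inI (lt_trans a0 y1) (lt_trans y2 bt).
have -> : bapp beta v y' = bapp beta v y + beta ^- v.1 * (y' - y) by rewrite /bapp; ring.
apply: size_res_shift => r rx.
rewrite mulrA divff ?mul1r ?gt_eqF ?expb_gt0//.
have -> : r + (y' - y) = y' + (r - y) by ring.
have /hab[h|h] := hV (vb _ Iy) rx; last by have [] := h _ y'ab.
by have := h _ yab; rewrite addrC subrK (res_in rx).
Qed.

End QuasiMultiplicative.

(** * Null sets for the outer Lebesgue measure *)

Section OuterLebesgue.
Context (R : realType).
Implicit Types (A : set R).

(** The outer measure makes sense for all sets, which spares the measurability
    of the exceptional sets. *)
Definition lam A : \bar R := ((@wlength R idfun)^* A)%mu.

Lemma lam_ge0 A : (0 <= lam A)%E. Proof. exact: outer_measure_ge0. Qed.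

Lemma le_lam A B : A `<=` B -> (lam A <= lam B)%E.
Proof. exact: (le_outer_measure ((@wlength R idfun)^*)%mu). Qed.

Lemma lam_itv p q : p <= q -> lam `[p, q]%classic = (q - p)%:E.
Proof.
move=> pq; have := @lebesgue_measure_itv R `[p, q].
rewrite /= lte_fin => E; rewrite [lam _](E : _ = _); case: ltrP => // qp.
by rewrite (@le_anti _ _ p q) ?subrr// pq.
Qed.

Lemma lam_bigcup (F : nat -> set R) A : (forall x, A x -> exists k, F k x) ->
  (lam A <= \sum_(0 <= k <oo) lam (F k))%E.
Proof.
move=> AF; apply: (@le_trans _ _ (lam (\bigcup_k F k))).
  by apply: le_lam => x /AF[k Fx]; exists k.
exact: (outer_measure_sigma_subadditive ((@wlength R idfun)^*)%mu).
Qed.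

Lemma lam_seq (T : eqType) (s : seq T) (F : T -> set R) A :
  (forall x, A x -> exists2 k, k \in s & F k x) ->
  (lam A <= \sum_(k <- s) lam (F k))%E.
Proof.
elim: s A => [|k s IH] A AF.
  rewrite big_nil (_ : A = set0); last by apply/seteqP; split => x // /AF[].
  by rewrite /lam outer_measure0.
rewrite big_cons; have h : A `<=` F k `|` (A `\` F k).
  by move=> x Ax; case: (pselect (F k x)); [left|right].
apply: le_trans (le_lam h) _.
apply: le_trans (outer_measureU2 ((@wlength R idfun)^*)%mu _ _) _.
apply: leeD => //; apply: IH => x [/AF[j]]; rewrite inE => /orP[/eqP ->//|js Fx _].
by exists j.
Qed.

Lemma lam_layers (T : eqType) (S : nat -> seq T) (F : T -> set R) A :
  (forall x, A x -> exists d, exists2 k, k \in S d & F k x) ->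
  (lam A <= \sum_(0 <= d <oo) \sum_(k <- S d) lam (F k))%E.
Proof.
move=> AF; apply: le_trans (lam_bigcup AF) _.
by apply: lee_nneseries => [d _ _|d _]; [exact: lam_ge0|exact: lam_seq].
Qed.

Lemma lam_le0 A : (forall e : R, 0 < e -> (lam A <= e%:E)%E) -> lam A = 0%E.
Proof.
move=> h; apply/eqP; rewrite eq_le lam_ge0 andbT; apply/lee_addgt0Pr => e e0.
by rewrite add0e; exact: h.
Qed.

Lemma lam0_bigcup (F : nat -> set R) A : (forall x, A x -> exists k, F k x) ->
  (forall k, lam (F k) = 0%E) -> lam A = 0%E.
Proof.
move=> AF F0; apply/eqP; rewrite eq_le lam_ge0 andbT.
by apply: le_trans (lam_bigcup AF) _; rewrite eseries0.
Qed.

Lemma lam0_layers (T : eqType) (S : nat -> seq T) (F : T -> set R) A :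
  (forall x, A x -> exists d, exists2 k, k \in S d & F k x) ->
  (forall d k, k \in S d -> lam (F k) = 0%E) -> lam A = 0%E.
Proof.
move=> AF F0; apply/eqP; rewrite eq_le lam_ge0 andbT.
apply: le_trans (lam_layers AF) _; rewrite eseries0// => d _ _.
by rewrite big_seq big1// => k /F0.
Qed.

Lemma lam0_sub A B : A `<=` B -> lam B = 0%E -> lam A = 0%E.
Proof.
by move=> AB B0; apply/eqP; rewrite eq_le lam_ge0 andbT -B0; exact: le_lam.
Qed.

Lemma lam0U A B : lam A = 0%E -> lam B = 0%E -> lam (A `|` B) = 0%E.
Proof.
move=> A0 B0; apply/eqP; rewrite eq_le lam_ge0 andbT.
apply: le_trans (outer_measureU2 ((@wlength R idfun)^*)%mu A B) _.
by rewrite -[X in (X + _)%E]/(lam A) -[X in (_ + X)%E]/(lam B) A0 B0 adde0.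
Qed.

Lemma geometric_small (c r e : R) : 0 <= r < 1 -> 0 < e -> exists n, c * r ^+ n <= e.
Proof.
move=> /andP[r0 r1] e0.
have : (fun n => c * r ^+ n) @ \oo --> c * 0.
  by apply: cvgMl_tmp; apply: cvg_expr; rewrite ger0_norm.
rewrite mulr0 => /cvgr0Pnorm_lt /(_ _ e0)[n _ /(_ n (leqnn n))] /= h.
by exists n; apply: le_trans (ler_norm _) (ltW h).
Qed.

Lemma eseries_geometric (c r : R) : 0 <= r < 1 ->
  (\sum_(0 <= k <oo) (c * r ^+ k)%:E = (c / (1 - r))%:E)%E.
Proof.
move=> /andP[r0 r1]; apply: cvg_lim => //.
rewrite (_ : (fun n => _) = EFin \o series (geometric c r)); last first.
  by apply/funext => n; rewrite /= /series/= sumEFin.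
apply/fine_cvgP; split; first exact: nearW.
by apply: cvg_geometric_series; rewrite ger0_norm.
Qed.

(** The Borel-Cantelli lemma: the limit superior is contained in the tail
    unions, whose measures are bounded by tails of a geometric series. *)
Lemma lam_limsup (Z : nat -> set R) (c r : R) : 0 <= r < 1 ->
  (forall j, (lam (Z j) <= (c * r ^+ j)%:E)%E) ->
  lam [set x | forall n, exists2 j, (n <= j)%N & Z j x] = 0%E.
Proof.
move=> /andP[r0 r1] Zc.
have c0 : 0 <= c.
  by have := le_trans (lam_ge0 _) (Zc 0%N); rewrite lee_fin expr0 mulr1.
have tail n : (lam [set x | forall n, exists2 j, (n <= j)%N & Z j x]
    <= (c * r ^+ n / (1 - r))%:E)%E.
  apply: le_trans (_ : (\sum_(0 <= k <oo) lam (Z (n + k)%N) <= _)%E).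
    apply: lam_bigcup => x /(_ n)[j nj Zx]; exists (j - n)%N.
    by rewrite subnKC.
  apply: le_trans (_ : (\sum_(0 <= k <oo) (c * r ^+ n * r ^+ k)%:E <= _)%E).
    apply: lee_nneseries => [k _ _|k _]; first exact: lam_ge0.
    by rewrite -mulrA -exprD.
  by rewrite eseries_geometric// r0.
apply: lam_le0 => e e0.
have [|n ne] := @geometric_small (c / (1 - r)) r e _ e0; first by rewrite r0.
apply: le_trans (tail n) _; rewrite lee_fin; apply: le_trans ne.
by rewrite mulrAC.
Qed.

End OuterLebesgue.

(** * Filling an interval with scaled copies of a subinterval *)

Section Tree.
Context (R : realType) (beta : R) (m : nat).
Context {hb : expanding beta m}.
Local Notation top := (top beta m).
Context (a b : R).
Hypotheses (a0 : 0 < a) (ab : a < b) (bt : b < top).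

Lemma span_gt0 : 0 < 6 * beta * top.
Proof.
have b0 : 0 < beta by exact: (@beta_gt0 _ _ m).
have t0 : 0 < top by exact: top_gt0.
by apply: mulr_gt0 => //; apply: mulr_gt0.
Qed.

Definition valid (I : R * R) := [/\ 0 <= I.1, I.1 < I.2 & I.2 <= top].

(** Placing the copy in the middle third keeps both gaps longer than a third
    of the interval; so the gaps shrink at most like [3^-d] with the depth [d],
    and the lengths of the branches grow at most linearly with it. *)
Definition middle_branch (I : R * R) (v : nat * R) := [/\ is_branch beta m v, (0 < v.1)%N,
  forall y, 0 <= y <= top -> (2 * I.1 + I.2) / 3 < bapp beta v y < (I.1 + 2 * I.2) / 3 &
  (I.2 - I.1) / (6 * beta * top) <= beta ^- v.1].

Lemma ex_middle_branch : exists br : R * R -> nat * R,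
  forall I, valid I -> middle_branch I (br I).
Proof.
suff /choice[br brP] : forall I, exists v, valid I -> middle_branch I v by exists br.
move=> I; case: (pselect (valid I)) => [[h1 h2 h3]|nI]; last by exists (0%N, 0).
have [|||v [v1 v2 v3 v4]] := @fill_branch _ beta m _ ((2 * I.1 + I.2) / 3) ((I.1 + 2 * I.2) / 3).
- lra.
- lra.
- lra.
exists v => _; split => //; apply: le_trans v4.
rewrite le_eqVlt; apply/orP; left; apply/eqP.
have t0 : top != 0 by rewrite gt_eqF// (lt_trans ltr01)// top_gt1.
have b0 : beta != 0 by rewrite gt_eqF// (@beta_gt0 _ _ m).
by field; rewrite t0.
Qed.

Context (br : R * R -> nat * R).
Hypothesis brP : forall I, valid I -> middle_branch I (br I).

Definition left_gap I : R * R := (I.1, bapp beta (br I) a).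
Definition right_gap I : R * R := (bapp beta (br I) b, I.2).

Fixpoint gaps d I : seq (R * R) :=
  if d is d'.+1 then gaps d' (left_gap I) ++ gaps d' (right_gap I) else [:: I].

Definition layer I d : seq (nat * R) := [seq br J | J <- gaps d I].

Lemma left_gap_valid I : valid I ->
  valid (left_gap I) /\ (I.2 - I.1) / 3 <= (left_gap I).2 - (left_gap I).1.
Proof.
move: (a0) (ab) (bt) => a0' ab' bt'.
move=> vI; have [_ _ /(_ a) h _] := brP vI; have [h1 h2 h3] := vI.
have {h} /andP[h4 h5] := h ltac:(by apply/andP; split; lra).
by split; [split|]; rewrite /=; lra.
Qed.

Lemma right_gap_valid I : valid I ->
  valid (right_gap I) /\ (I.2 - I.1) / 3 <= (right_gap I).2 - (right_gap I).1.
Proof.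
move: (a0) (ab) (bt) => a0' ab' bt'.
move=> vI; have [_ _ /(_ b) h _] := brP vI; have [h1 h2 h3] := vI.
have {h} /andP[h4 h5] := h ltac:(by apply/andP; split; lra).
by split; [split|]; rewrite /=; lra.
Qed.

Lemma layer_branch I d v : valid I -> v \in layer I d ->
  [/\ is_branch beta m v, (0 < v.1)%N & forall y, 0 <= y <= top -> I.1 < bapp beta v y < I.2].
Proof.
move: (a0) (ab) (bt) => a0' ab' bt'.
elim: d I => [|d IH] I vI.
  rewrite inE => /eqP ->; have [h1 h2 h3 _] := brP vI; split => // y /h3/andP[? ?].
  by have [? ? ?] := vI; apply/andP; split; lra.
have [vL _] := left_gap_valid vI; have [vR _] := right_gap_valid vI.
rewrite /layer /= map_cat mem_cat => /orP[/(IH _ vL)|/(IH _ vR)] [h1 h2 h3];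
  split => // y /h3 /andP[h4 h5]; have [_ l2 _] := vL; have [_ r2 r3] := vR; have [i1 i2 i3] := vI.
- have [_ _ /(_ a) h _] := brP vI; have {h} /andP[? ?] := h ltac:(by apply/andP; split; lra).
  by move: h4 h5 => /=; move=> ? ?; apply/andP; split; lra.
- have [_ _ /(_ b) h _] := brP vI; have {h} /andP[? ?] := h ltac:(by apply/andP; split; lra).
  by move: h4 h5 => /=; move=> ? ?; apply/andP; split; lra.
Qed.

Lemma layer_length I d v : valid I -> v \in layer I d ->
  beta ^+ v.1 <= 6 * beta * top / (I.2 - I.1) * 3 ^+ d.
Proof.
have t0 := span_gt0.
elim: d I => [|d IH] I vI.
  rewrite inE => /eqP ->; have [_ _ _ h] := brP vI; have [_ h2 _] := vI.
  rewrite expr0 mulr1 -[beta ^+ _]invrK -[X in _ <= X]invrK lef_pV2.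
  - by rewrite invfM invrK mulrC.
  - by rewrite posrE invr_gt0 expb_gt0.
  - by rewrite posrE invr_gt0 divr_gt0// subr_gt0.
have [vL wL] := left_gap_valid vI; have [vR wR] := right_gap_valid vI; have [_ h2 _] := vI.
have key J : valid J -> (I.2 - I.1) / 3 <= J.2 - J.1 ->
   6 * beta * top / (J.2 - J.1) * 3 ^+ d <= 6 * beta * top / (I.2 - I.1) * 3 ^+ d.+1.
  move=> [_ j2 _] w; rewrite exprS mulrA ler_wpM2r ?exprn_ge0// ler_pdivrMr ?subr_gt0//.
  have q0 : 0 <= 6 * beta * top / (I.2 - I.1) by apply: divr_ge0; rewrite ?subr_ge0 ltW.
  have qE : 6 * beta * top / (I.2 - I.1) * (I.2 - I.1) = 6 * beta * top.
    by rewrite divfK// gt_eqF// subr_gt0.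
  have := ler_wpM2l q0 w; rewrite mulrA qE; lra.
rewrite /layer /= map_cat mem_cat => /orP[/(IH _ vL)|/(IH _ vR)] h; apply: le_trans h _;
  exact: key.
Qed.

Lemma layer_cover I d x : valid I -> I.1 <= x <= I.2 ->
  (exists d', exists2 v, v \in layer I d' & bapp beta v a < x < bapp beta v b) \/
  exists2 J, J \in gaps d I & J.1 <= x <= J.2.
Proof.
move: (a0) (ab) (bt) => a0' ab' bt'.
elim: d I => [|d IH] I vI xI; first by right; exists I; rewrite // mem_head.
have [vL _] := left_gap_valid vI; have [vR _] := right_gap_valid vI; case/andP: xI => x1 x2.
have [xl|lx] := leP x (bapp beta (br I) a).
  have [|[d' [v vl xv]]|[J Jl xJ]] := IH (left_gap I) vL.
  - by rewrite /= x1.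
  - by left; exists d'.+1; exists v; rewrite // /layer/= map_cat mem_cat vl.
  - by right; exists J; rewrite //= mem_cat Jl.
have [rx|xr] := leP (bapp beta (br I) b) x.
  have [|[d' [v vl xv]]|[J Jl xJ]] := IH (right_gap I) vR.
  - by rewrite /= x2 andbT.
  - by left; exists d'.+1; exists v; rewrite // /layer/= map_cat mem_cat vl orbT.
  - by right; exists J; rewrite //= mem_cat Jl orbT.
by left; exists 0%N; exists (br I); rewrite ?lx// mem_head.
Qed.

Lemma gaps_valid I d J : valid I -> J \in gaps d I -> valid J.
Proof.
elim: d I => [|d IH] I vI; first by rewrite inE => /eqP ->.
have [vL _] := left_gap_valid vI; have [vR _] := right_gap_valid vI.
by rewrite /= mem_cat => /orP[/(IH _ vL)|/(IH _ vR)].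
Qed.

Definition width I d : R := \sum_(J <- gaps d I) (J.2 - J.1).

Lemma widthS I d : width I d.+1 = width (left_gap I) d + width (right_gap I) d.
Proof. by rewrite /width /= big_cat. Qed.

Lemma layerS I d : layer I d.+1 = layer (left_gap I) d ++ layer (right_gap I) d.
Proof. by rewrite /layer /= map_cat. Qed.

Lemma width_split I d :
  width I d = (b - a) * \sum_(v <- layer I d) beta ^- v.1 + width I d.+1.
Proof.
elim: d I => [|d IH] I.
  by rewrite /width /layer /= !big_cons !big_nil /= /bapp; ring.
rewrite [LHS]widthS (IH (left_gap I)) (IH (right_gap I)) layerS big_cat /= [width I d.+2]widthS.
ring.
Qed.

(** A lower bound for the proportion of an interval that its copy of ]a, b[ covers. *)
Definition fill_ratio : R := (b - a) / (6 * beta * top).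

Lemma fill_ratio_gt0 : 0 < fill_ratio.
Proof.
move: (a0) (ab) (bt) => a0' ab' bt'.
by rewrite divr_gt0 ?subr_gt0// span_gt0.
Qed.

Lemma fill_ratio_lt1 : fill_ratio < 1.
Proof.
move: (a0) (ab) (bt) => a0' ab' bt'.
have t1 : 1 < top by exact: top_gt1.
have b1 : 1 < beta by exact: (@base_gt1 _ _ m).
rewrite ltr_pdivrMr ?mul1r; last exact: span_gt0.
nra.
Qed.

Lemma width_decay I d : valid I -> width I d.+1 <= (1 - fill_ratio) * width I d.
Proof.
move: (a0) (ab) (bt) => a0' ab' bt'.
elim: d I => [|d IH] I vI.
  rewrite /width /= !big_cons !big_nil /= /bapp /fill_ratio.
  have [_ _ _ h] := brP vI; have ba : 0 <= b - a by lra.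
  by have := ler_wpM2l ba h; lra.
have [vL _] := left_gap_valid vI; have [vR _] := right_gap_valid vI.
by rewrite widthS [width I d.+1]widthS mulrDr; apply: lerD; exact: IH.
Qed.

Lemma width_le I d : valid I -> width I d <= (1 - fill_ratio) ^+ d * (I.2 - I.1).
Proof.
move=> vI; elim: d => [|d IH]; first by rewrite /width/= big_cons big_nil expr0 mul1r addr0.
apply: le_trans (width_decay d vI) _; rewrite exprS -mulrA ler_wpM2l//.
by rewrite subr_ge0 ltW// fill_ratio_lt1.
Qed.

Lemma width_ge0 I d : valid I -> 0 <= width I d.
Proof.
move=> vI; rewrite /width big_seq; apply: sumr_ge0 => J /(gaps_valid vI)[_ h _].
by rewrite subr_ge0 ltW.
Qed.

Lemma width_cvg I : valid I -> width I d @[d --> \oo] --> (0 : R).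
Proof.
move=> vI; apply: (@squeeze_cvgr _ _ _ _ (fun=> 0) (fun d => (I.2 - I.1) * (1 - fill_ratio) ^+ d)).
- by apply: nearW => d; rewrite width_ge0//= mulrC width_le.
- exact: cvg_cst.
- rewrite -[X in _ --> X](mulr0 (I.2 - I.1)); apply: cvgMl_tmp; apply: cvg_expr.
  by have := fill_ratio_gt0; have := fill_ratio_lt1; move=> ? ?; rewrite ger0_norm; lra.
Qed.

Lemma layer_total I : valid I ->
  (\sum_(0 <= d <oo) \sum_(v <- layer I d) (beta ^- v.1)%:E
    = ((I.2 - I.1) / (b - a))%:E)%E.
Proof.
move=> vI; have ba : b - a != 0 by rewrite gt_eqF// subr_gt0.
have psum n : \sum_(0 <= d < n) \sum_(v <- layer I d) beta ^- v.1
    = (width I 0 - width I n) / (b - a).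
  elim: n => [|n IH]; first by rewrite big_geq// subrr mul0r.
  rewrite big_nat_recr//= IH (width_split I n).
  by move: (width _ 0) (width _ _.+1) (\sum_(v <- _) _) => x y s; field.
apply: cvg_lim => //.
rewrite (_ : (fun n => _) = EFin \o fun n => (width I 0 - width I n) / (b - a)); last first.
  apply/funext => n /=; rewrite -psum -sumEFin.
  by apply: eq_bigr => d _; rewrite sumEFin.
apply/fine_cvgP; split; first exact: nearW.
apply: cvgMr_tmp; rewrite -[X in _ --> X]subr0; apply: cvgB; last exact: width_cvg.
by rewrite /width/= big_cons big_nil addr0; exact: cvg_cst.
Qed.

Lemma expr_near1 (s : nat) (g : R) : 1 < g -> exists2 z, 1 < z & z ^+ s < g.
Proof.
elim: s g => [|s IH] g g1; first by exists 2; rewrite ?expr0// ltr1n.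
have [|z1 h1 h2] := IH ((1 + g) / 2); first lra.
(* The factor g is shared between z ^+ s and the last power of z. *)
have g0 : 0 < (1 + g) / 2 by lra.
exists (Num.min z1 (g / ((1 + g) / 2))).
  by rewrite lt_min h1/= ltr_pdivlMr// mul1r; lra.
set z := Num.min _ _; have z0 : 0 < z.
  by rewrite lt_min divr_gt0 ?andbT//; lra.
rewrite exprS.
have a1 : z <= g / ((1 + g) / 2) by rewrite ge_min lexx orbT.
have a2 : z ^+ s < (1 + g) / 2.
  by apply: le_lt_trans h2; rewrite lerXn2r ?nnegrE ?ge_min ?lexx//; lra.
apply: (@lt_le_trans _ _ (z * ((1 + g) / 2))); first by rewrite ltr_pM2l.
by rewrite -ler_pdivlMr.
Qed.

Lemma expb_unbounded (c : R) : exists n, c <= beta ^+ n.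
Proof.
have [|n hn] := @expbV_small _ beta m _ (Num.max 1 c)^-1.
  by rewrite invr_gt0 lt_max ltr01.
exists n; have c0 : 0 < Num.max 1 c by rewrite lt_max ltr01.
move: hn; rewrite ltf_pV2 ?posrE ?(expb_gt0 (m := m))// => /ltW h.
by apply: le_trans h; rewrite le_max lexx orbT.
Qed.

(** At depth [d] the lengths are [O(d)] while the total probability decays like
    [(1 - fill_ratio)^d]; so any base [z] close enough to 1 will do. *)
Lemma layer_moment I : valid I -> exists2 z : R, 1 < z &
  (\sum_(0 <= d <oo) \sum_(v <- layer I d) (beta ^- v.1 * z ^+ v.1)%:E < +oo)%E.
Proof.
move=> vI; have k0 := fill_ratio_gt0; have k1 := fill_ratio_lt1.
(* beta ^+ s' absorbs the width of I, and each level costs at most s steps. *)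
have [s hs] := expb_unbounded 3; have [s' hs'] := expb_unbounded (6 * beta * top / (I.2 - I.1)).
have [|z z1 zs] := @expr_near1 s (1 - fill_ratio)^-1; first by rewrite invf_gt1; lra.
have z0 : 0 < z by lra.
have k1' : 0 < 1 - fill_ratio by lra.
have b1 : 1 < beta by exact: (@base_gt1 _ _ m).
exists z => //; have [_ I12 _] := vI.
have len d v : v \in layer I d -> (v.1 <= s' + s * d)%N.
  move=> /(layer_length vI) h; rewrite -(ler_eXn2l b1); apply: le_trans h _.
  rewrite exprD exprM ler_pM ?exprn_ge0//.
    by rewrite divr_ge0 ?ltW ?span_gt0// subr_gt0.
  by rewrite lerXn2r// nnegrE ?ler0n// exprn_ge0// ltW// (lt_trans ltr01).
have Pd d : \sum_(v <- layer I d) beta ^- v.1 <= (1 - fill_ratio) ^+ d * ((I.2 - I.1) / (b - a)).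
  rewrite mulrA ler_pdivlMr ?subr_gt0//; apply: le_trans (width_le d vI).
  by rewrite (width_split I d) mulrC lerDl width_ge0.
pose c := z ^+ s' * ((I.2 - I.1) / (b - a)); pose r := z ^+ s * (1 - fill_ratio).
have r1 : 0 <= r < 1.
  rewrite /r mulr_ge0 ?exprn_ge0 ?ltW//=.
  by move: zs; rewrite -[(1 - fill_ratio)^-1]mul1r ltr_pdivlMr.
apply: (@le_lt_trans _ _ (\sum_(0 <= d <oo) (c * r ^+ d)%:E)%E); last first.
  by rewrite eseries_geometric// ltry.
apply: lee_nneseries => [d _ _|d _].
  rewrite sumEFin lee_fin sumr_ge0// => v _.
  by rewrite mulr_ge0 ?invr_ge0 ?exprn_ge0 ?ltW// (lt_trans ltr01).
rewrite sumEFin lee_fin; apply: (@le_trans _ _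
    (\sum_(v <- layer I d) beta ^- v.1 * z ^+ (s' + s * d))).
  rewrite big_seq [X in _ <= X]big_seq; apply: ler_sum => v /len vs.
  by rewrite ler_wpM2l ?invr_ge0 ?exprn_ge0 ?ler_weXn2l// ?ltW// (lt_trans ltr01).
rewrite -mulr_suml /c /r exprMn -exprM exprD.
have zz : 0 <= z ^+ s' * z ^+ (s * d) by rewrite mulr_ge0 ?exprn_ge0// ltW.
have := ler_wpM2r zz (Pd d); move=> h; apply: le_trans h _.
rewrite le_eqVlt; apply/orP; left; apply/eqP; ring.
Qed.

Definition uncovered (S : nat -> seq (nat * R)) (p q : R) : set R := [set x | p <= x <= q /\
    ~ exists d, exists2 v, v \in S d & bapp beta v a < x < bapp beta v b].

(** The uncovered part is contained in the gaps of each depth, whose total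
    width tends to 0. The branch [c] avoids a separate appeal to the behaviour of
    null sets under affine maps. *)
Lemma layer_null I c : valid I ->
  lam (bapp beta c @` uncovered (layer I) I.1 I.2) = 0%E.
Proof.
move=> vI; have bc : 0 < beta ^- c.1 by rewrite invr_gt0 (expb_gt0 (m := m)).
set A := uncovered _ _ _.
have le d : (lam (bapp beta c @` A) <= (beta ^- c.1 * width I d)%:E)%E.
  apply: le_trans (@lam_seq _ _ (gaps d I)
    (fun J => `[bapp beta c J.1, bapp beta c J.2]%classic) _ _) _.
    move=> _ [x [xI nx] <-]; have [//|[J JI xJ]] := layer_cover d vI xI.
    by exists J => //=; rewrite in_itv/= !lerD2r !ler_pM2l.
  rewrite /width mulr_sumr -sumEFin big_seq [X in (_ <= X)%E]big_seq.
  apply: lee_sum => J /(gaps_valid vI)[_ J12 _].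
  rewrite lam_itv ?lee_fin /bapp; last by rewrite lerD2r ler_pM2l// ltW.
  by rewrite le_eqVlt; apply/orP; left; apply/eqP; ring.
apply: lam_le0 => e e0.
have [|n ne] := @geometric_small _ (beta ^- c.1 * (I.2 - I.1)) (1 - fill_ratio) e _ e0.
  by have := fill_ratio_gt0; have := fill_ratio_lt1; move=> ? ?; apply/andP; split; lra.
apply: le_trans (le n) _; rewrite lee_fin; apply: le_trans ne.
by rewrite -mulrA [X in _ <= _ * X]mulrC ler_pM2l// width_le.
Qed.

End Tree.

Section System.
Context (R : realType) (beta : R) (m : nat).
Context {hb : expanding beta m}.
Local Notation top := (top beta m).

(** A countable family of branches, arranged in finite layers, whose images of
    ]a, b[ fill ]p, q[ up to a null set. *)
Record filling (a b : R) (S : nat -> seq (nat * R)) (p q : R) : Prop := Filling {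
  filling_branch : forall d v, v \in S d -> is_branch beta m v;
  filling_pos : forall d v, v \in S d -> (0 < v.1)%N;
  filling_sub : forall d v, v \in S d -> p < bapp beta v a /\ bapp beta v b < q;
  filling_total : (\sum_(0 <= d <oo) \sum_(v <- S d) (beta ^- v.1)%:E
    = ((q - p) / (b - a))%:E)%E;
  filling_moment : exists2 z : R, 1 < z &
    (\sum_(0 <= d <oo) \sum_(v <- S d) (beta ^- v.1 * z ^+ v.1)%:E < +oo)%E;
  filling_null : forall c, lam (bapp beta c @` uncovered beta a b S p q) = 0%E }.

Lemma filling_ex (a b p q : R) : 0 < a -> a < b -> b < top -> 0 <= p -> p < q -> q <= top ->
  exists S, filling a b S p q.
Proof.
move=> a0 ab bt p0 pq qt; have [br brP] := ex_middle_branch.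
have vI : valid beta m (p, q) by split.
exists (layer beta a b br (p, q)).
have lb d v : v \in layer beta a b br (p, q) d -> _ := layer_branch a0 ab bt brP vI.
split.
- by move=> d v /lb[].
- by move=> d v /lb[].
- move=> d v /lb[_ _ h]; have /h/andP[? _] : 0 <= a <= top by apply/andP; split; lra.
  by have /h/andP[_ ?] : 0 <= b <= top by apply/andP; split; lra.
- exact: (layer_total a0 ab bt brP vI).
- exact: (layer_moment a0 ab bt brP vI).
- by move=> c; exact: (layer_null a0 ab bt brP c vI).
Qed.

End System.

(** * Words of branches and itineraries *)

Section Words.
Context (R : realType) (beta : R) (m : nat).
Context {hb : expanding beta m}.
Context (a b : R) (S : nat -> seq (nat * R)).
Hypotheses (ab : a < b) (fS : filling beta m a b S a b).

Definition letter (v : nat * R) := exists d, v \in S d.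
Definition word (w : seq (nat * R)) := forall v, v \in w -> letter v.

Lemma word_cons v w : word (v :: w) <-> letter v /\ word w.
Proof.
split=> [h|[lv ww] u]; last by rewrite inE => /orP[/eqP ->|/ww].
by split=> [|u uw]; apply: h; rewrite inE ?eqxx// uw orbT.
Qed.

Lemma word_cat u w : word (u ++ w) <-> word u /\ word w.
Proof.
split=> [h|[h1 h2] v]; last by rewrite mem_cat => /orP[/h1|/h2].
by split=> v vu; apply: h; rewrite mem_cat vu ?orbT.
Qed.

Lemma prob_gt0 (v : nat * R) : 0 < beta ^- v.1.
Proof. by rewrite invr_gt0 (expb_gt0 (m := m)). Qed.

Lemma prob_ge0 (v : nat * R) : (0 <= (beta ^- v.1)%:E)%E.
Proof. by rewrite lee_fin ltW// prob_gt0. Qed.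

Local Open Scope ereal_scope.

(** The expectation of [f] for the probability that gives the mass [beta^-n] to
    a branch of length [n], the proportion of ]a, b[ that its cell occupies. *)
Definition mean (f : nat * R -> \bar R) : \bar R :=
  \sum_(0 <= d <oo) \sum_(v <- S d) ((beta ^- v.1)%R%:E * f v).

Lemma layer_ge0 f d : (forall v, 0 <= f v) ->
  0 <= \sum_(v <- S d) ((beta ^- v.1)%R%:E * f v).
Proof. by move=> f0; apply: sume_ge0 => v _; rewrite mule_ge0// prob_ge0. Qed.

Lemma mean_ge0 f : (forall v, 0 <= f v) -> 0 <= mean f.
Proof. by move=> f0; apply: nneseries_ge0 => d _ _; exact: layer_ge0. Qed.

Lemma mean_le f g : (forall v, 0 <= f v) -> (forall v, letter v -> f v <= g v) ->
  mean f <= mean g.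
Proof.
move=> f0 fg; apply: lee_nneseries => d _; first by move=> _; exact: layer_ge0.
rewrite big_seq [leRHS]big_seq; apply: lee_sum => v vd.
by rewrite lee_wpmul2l ?prob_ge0//; apply: fg; exists d.
Qed.

Lemma meanD f g : (forall v, 0 <= f v) -> (forall v, 0 <= g v) ->
  mean (fun v => f v + g v) = mean f + mean g.
Proof.
move=> f0 g0; rewrite /mean -nneseriesD//.
- apply: eq_eseriesr => d _; rewrite -big_split; apply: eq_bigr => v _.
  by rewrite ge0_muleDr.
- by move=> d _ _; exact: layer_ge0.
- by move=> d _ _; exact: layer_ge0.
Qed.

Lemma meanZ (c : R) f : (forall v, 0 <= f v) -> mean (fun v => c%:E * f v) = c%:E * mean f.
Proof.
move=> f0; rewrite /mean -nneseriesZl; last by move=> d _; exact: layer_ge0.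
apply: eq_eseriesr => d _; rewrite ge0_sume_distrr; last first.
  by move=> v _; rewrite mule_ge0// prob_ge0.
by apply: eq_bigr => v _; rewrite muleCA.
Qed.

Lemma mean1 : mean (fun=> 1) = 1.
Proof.
transitivity (((b - a) / (b - a))%R%:E : \bar R).
  rewrite -(filling_total fS); apply: eq_eseriesr => d _.
  by apply: eq_bigr => v _; rewrite mule1.
by rewrite divff// gt_eqF// subr_gt0.
Qed.

(** The expectation over [k] independent branches, first branch outermost. *)
Fixpoint wmean k (f : seq (nat * R) -> \bar R) : \bar R :=
  if k is k'.+1 then mean (fun v => wmean k' (fun w => f (v :: w))) else f [::].

Lemma wmean_ge0 k f : (forall w, 0 <= f w) -> 0 <= wmean k f.
Proof. by elim: k f => //= k IH f f0; apply: mean_ge0 => v; exact: IH. Qed.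

Lemma wmean_le k f g : (forall w, 0 <= f w) ->
  (forall w, size w = k -> word w -> f w <= g w) -> wmean k f <= wmean k g.
Proof.
elim: k f g => [|k IH] f g f0 fg /=; first by apply: fg.
apply: mean_le => [v|v lv]; first exact: wmean_ge0.
apply: IH => // w sw ww; apply: fg; first by rewrite /= sw.
exact/word_cons.
Qed.

Lemma wmeanD k f g : (forall w, 0 <= f w) -> (forall w, 0 <= g w) ->
  wmean k (fun w => f w + g w) = wmean k f + wmean k g.
Proof.
elim: k f g => //= k IH f g f0 g0; rewrite -meanD.
- by congr mean; apply/funext => v; exact: IH.
- by move=> v; exact: wmean_ge0.
- by move=> v; exact: wmean_ge0.
Qed.

Lemma wmeanZ k (c : R) f : (forall w, 0 <= f w) ->
  wmean k (fun w => c%:E * f w) = c%:E * wmean k f.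
Proof.
elim: k f => //= k IH f f0; rewrite -meanZ; last by move=> v; exact: wmean_ge0.
by congr mean; apply/funext => v; exact: IH.
Qed.

Lemma wmean1 k : wmean k (fun=> 1) = 1.
Proof. by elim: k => //= k IH; rewrite IH mean1. Qed.

Lemma wmean_cst k (c : R) : wmean k (fun=> c%:E) = c%:E.
Proof.
rewrite -[RHS]mule1 -(wmean1 k) -wmeanZ//; congr wmean; apply/funext => w.
by rewrite mule1.
Qed.

Lemma wmean_cat k l f : wmean (k + l) f = wmean k (fun u => wmean l (fun w => f (u ++ w))).
Proof. by elim: k f => //= k IH f; congr mean; apply/funext => v; exact: IH. Qed.

Local Close Scope ereal_scope.

Definition wbranch (w : seq (nat * R)) : nat * R := foldr (bcomp beta) (0%N, 0) w.
Definition len w : nat := (wbranch w).1.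

Lemma bcomp0l (v : nat * R) : bcomp beta (0%N, 0) v = v.
Proof. by case: v => n c; rewrite /bcomp /= expr0 invr1 mul1r addr0. Qed.

Lemma bcomp0r (v : nat * R) : bcomp beta v (0%N, 0) = v.
Proof. by case: v => n c; rewrite /bcomp /= mulr0 add0r addn0. Qed.

Lemma bcompA u v w : bcomp beta u (bcomp beta v w) = bcomp beta (bcomp beta u v) w.
Proof.
by rewrite /bcomp /= addnA; congr pair; rewrite exprD invfM mulrDr; ring.
Qed.

Lemma wbranch_cat u w : wbranch (u ++ w) = bcomp beta (wbranch u) (wbranch w).
Proof. by elim: u => [|v u IH] /=; rewrite ?bcomp0l// IH bcompA. Qed.

Lemma len_cat u w : len (u ++ w) = (len u + len w)%N.
Proof. by rewrite /len wbranch_cat. Qed.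

Lemma wbranch_branch w : word w -> is_branch beta m (wbranch w).
Proof.
elim: w => [|v w IH]; first by move=> _; exact: is_branch0.
move=> /word_cons[[d vd] ww]; apply: is_branch_comp (IH ww).
exact: (filling_branch fS vd).
Qed.

Lemma size_le_len w : word w -> (size w <= len w)%N.
Proof.
elim: w => //= v w IH /word_cons[[d vd] ww].
rewrite /len /= -add1n leq_add//; first exact: (filling_pos fS vd).
exact: IH.
Qed.

Definition cell (c : nat * R) : set R := [set x | exists2 y, a < y < b & x = bapp beta c y].

Lemma lam_cell c : (lam (cell c) <= ((b - a) * beta ^- c.1)%:E)%E.
Proof.
have p0 := prob_gt0 c.
apply: le_trans (_ : (lam `[bapp beta c a, bapp beta c b]%classic <= _)%E).
  apply: le_lam => x [y /andP[ya yb] ->] /=.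
  by rewrite in_itv/= !lerD2r !ler_pM2l// !ltW.
rewrite lam_itv ?lee_fin /bapp; last by rewrite lerD2r ler_pM2l// ltW.
by rewrite le_eqVlt; apply/orP; left; apply/eqP; ring.
Qed.

(** A union bound over the cells, each of measure proportional to the
    probability of its word, followed by Markov's inequality for [g]. *)
Lemma lam_words k c (B : seq (nat * R) -> Prop) (g : seq (nat * R) -> \bar R) :
  (forall w, 0 <= g w)%E -> (forall w, size w = k -> word w -> B w -> 1 <= g w)%E ->
  (lam [set x | exists w, [/\ size w = k, word w, B w & cell (bcomp beta c (wbranch w)) x]]
    <= ((b - a) * beta ^- c.1)%:E * wmean k g)%E.
Proof.
elim: k c B g => [|k IH] c B g g0 Bg.
  have c0 : (0 <= ((b - a) * beta ^- c.1)%:E)%E.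
    by rewrite lee_fin mulr_ge0// ?subr_ge0 ltW// prob_gt0.
  case: (pselect (B [::])) => [B0|nB]; last first.
    rewrite (_ : [set x | _] = set0); last first.
      by apply/seteqP; split => x // [w [/size0nil -> _]].
    by rewrite /lam outer_measure0 mule_ge0//=.
  apply: le_trans (_ : (lam (cell c) <= _)%E).
    by apply: le_lam => x [w [/size0nil -> _ _]]; rewrite /wbranch/= bcomp0r.
  apply: le_trans (lam_cell c) _; rewrite -[leLHS]mule1 lee_wpmul2l//.
  by apply: Bg.
pose F v := [set x | exists w, [/\ size w = k, word w, B (v :: w) &
  cell (bcomp beta (bcomp beta c v) (wbranch w)) x]].
apply: le_trans (@lam_layers _ _ S F _ _) _.
  move=> x [w [sw ww Bw]]; case: w sw ww Bw => // v w [sw] /word_cons[[d vd] ww] Bw.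
  rewrite /wbranch /= bcompA => xc.
  by exists d, v => //; exists w.
rewrite -meanZ; last by move=> v; exact: wmean_ge0.
apply: lee_nneseries => [d _ _|d _]; first by apply: sume_ge0 => v _; exact: lam_ge0.
rewrite big_seq [leRHS]big_seq; apply: lee_sum => v vd.
apply: le_trans (IH (bcomp beta c v) _ (fun w => g (v :: w)) _ _) _ => //.
  move=> w sw ww Bw; apply: Bg => //; first by rewrite /= sw.
  by apply/word_cons; split => //; exists d.
rewrite muleA -EFinM /bcomp /= exprD invfM [X in X%:E]mulrA.
by rewrite le_eqVlt; apply/orP; left; apply/eqP; congr (_%:E * _)%E; ring.
Qed.

(** The points whose itinerary stops after [k] branches, at a point that no
    cell of the filling covers. *)
Definition dead k c : set R := [set x | exists w y, [/\ size w = k, word w, a < y < b,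
  uncovered beta a b S a b y & x = bapp beta (bcomp beta c (wbranch w)) y]].

Lemma lam_dead k c : lam (dead k c) = 0%E.
Proof.
elim: k c => [|k IH] c.
  apply: lam0_sub (filling_null fS c) => x [w [y [/size0nil -> _ _ yu ->]]].
  by rewrite /wbranch /= bcomp0r; exists y.
apply: (@lam0_layers _ _ S (fun v => dead k (bcomp beta c v))) => [x|d v _]; last exact: IH.
case=> w [y [sw ww yab yu ->]]; case: w sw ww => // v w [sw] /word_cons[[d vd] ww].
by exists d, v => //; exists w, y; split => //; rewrite /wbranch /= bcompA.
Qed.

Definition itinerary (y : R) (vs : nat -> nat * R) (ys : nat -> R) := ys 0%N = y /\
  forall k, [/\ letter (vs k), a < ys k < b & ys k = bapp beta (vs k) (ys k.+1)].

Lemma mkseq_word y vs ys k : itinerary y vs ys -> word (mkseq vs k).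
Proof. by move=> [_ h] v /mapP[i _ ->]; have [] := h i. Qed.

Lemma itinerary_app y vs ys k : itinerary y vs ys ->
  y = bapp beta (wbranch (mkseq vs k)) (ys k).
Proof.
move=> [y0 h]; elim: k => [|k ->].
  by rewrite y0 /wbranch /= /bapp /= expr0 invr1 mul1r addr0.
rewrite mkseqS -cats1 wbranch_cat bapp_comp /wbranch /= bcomp0r.
by have [_ _ <-] := h k.
Qed.

(** Follow the cells; an itinerary could only break off in some [dead k]. *)
Lemma itinerary_ex c y : a < y < b -> (forall k, ~ dead k c (bapp beta c y)) ->
  exists vs ys, itinerary y vs ys.
Proof.
move=> yab nd.
have /choice[nxt nxtP] : forall z, exists n : (nat * R) * R, a < z < b ->
    ~ uncovered beta a b S a b z ->
    [/\ letter n.1, a < n.2 < b & z = bapp beta n.1 n.2].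
  move=> z; case: (pselect (a < z < b)) => [zab|nz]; last by exists ((0%N, 0), 0).
  case: (pselect (uncovered beta a b S a b z)) => [u|nu]; first by exists ((0%N, 0), 0).
  have [d [v vd zv]] : exists d, exists2 v, v \in S d & bapp beta v a < z < bapp beta v b.
    apply: contrapT => h; apply: nu; split => //.
    by case/andP: zab => *; rewrite !ltW.
  have [z' z'ab zE] := image_itv zv.
  by exists (v, z') => _ _; split => //=; exists d.
pose ys k := iter k (fun z => (nxt z).2) y.
pose vs k := (nxt (ys k)).1.
have inv k : [/\ word (mkseq vs k), a < ys k < b & y = bapp beta (wbranch (mkseq vs k)) (ys k)].
  elim: k => [|k [h1 h2 h3]].
    by split => //; rewrite /wbranch /= /bapp /= expr0 invr1 mul1r addr0.
  have nu : ~ uncovered beta a b S a b (ys k).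
    move=> u; apply: (nd k); exists (mkseq vs k), (ys k); split => //.
      by rewrite size_mkseq.
    by rewrite bapp_comp -h3.
  have [l1 l2 l3] := nxtP _ h2 nu.
  split => //; rewrite mkseqS -cats1.
    by apply/word_cat; split => // v; rewrite inE => /eqP ->.
  by rewrite wbranch_cat bapp_comp /wbranch /= bcomp0r -l3.
exists vs, ys; split => // k; have [h1 h2 h3] := inv k.
have nu : ~ uncovered beta a b S a b (ys k).
  move=> u; apply: (nd k); exists (mkseq vs k), (ys k); split => //.
    by rewrite size_mkseq.
  by rewrite bapp_comp -h3.
by have [l1 _ l3] := nxtP _ h2 nu; split.
Qed.

(** By independence the moment of a word is the product of those of its letters. *)
Lemma wmean_moment : exists2 z : R, 1 < z &
  forall k, (wmean k (fun w => (z ^+ len w)%:E) < +oo)%E.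
Proof.
have [z z1 zf] := filling_moment fS; exists z => //; elim=> [|k IH]; first by rewrite /= ltry.
have z0 n : (0 <= (z ^+ n)%:E)%E by rewrite lee_fin exprn_ge0// ltW// (lt_trans ltr01).
have fin : wmean k (fun w => (z ^+ len w)%:E) \is a fin_num.
  by rewrite ge0_fin_numE// wmean_ge0.
have E v : wmean k (fun w => (z ^+ len (v :: w))%:E) =
    ((fine (wmean k (fun w => (z ^+ len w)%:E)))%:E * (z ^+ v.1)%:E)%E.
  rewrite fineK// muleC -wmeanZ//; congr wmean; apply/funext => w.
  by rewrite -EFinM -exprD.
rewrite /= (funext E) meanZ//; apply: lte_mul_pinfty => //.
by rewrite lee_fin fine_ge0// wmean_ge0.
Qed.

End Words.

(** * Exponential deviation bounds for sums over independent blocks *)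

Section ExpBounds.
Context (R : realType).
Implicit Types (x y : R).

(** [expR y - 1 <= y * expR y] gives [expR y - 1 - y <= y * (expR y - 1)]; bound
    the last factor according to the sign of [y]. *)
Lemma expR_taylor y : expR y <= 1 + y + y ^+ 2 * expR `|y|.
Proof.
have e0 := expR_gt0 y.
have h1 : expR y - 1 <= y * expR y.
  have := expR_ge1Dx (- y) ; rewrite expRN => h.
  have := ler_wpM2r (ltW e0) h; rewrite mulVf ?gt_eqF//; lra.
have h2 := expR_ge1Dx y.
have [y0|y0] := leP 0 y.
  rewrite ger0_norm//; have : y * (expR y - 1) <= y * (y * expR y) by rewrite ler_wpM2l.
  by rewrite expr2 -mulrA; lra.
have e1 : 1 <= expR `|y| by have := expR_ge1Dx `|y|; have := normr_ge0 y; lra.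
have : y ^+ 2 * 1 <= y ^+ 2 * expR `|y| by rewrite ler_wpM2l// sqr_ge0.
have : y * (expR y - 1) <= y * y by apply: ler_wnM2l; [exact: ltW|lra].
rewrite expr2; lra.
Qed.

Lemma sqr_le_expR x : 0 <= x -> x ^+ 2 <= 4 * expR x.
Proof.
move=> x0; have -> : expR x = expR (x / 2) ^+ 2 by rewrite -expRM_natl; congr expR; field.
have := expR_ge1Dx (x / 2) => h.
have : (x / 2) ^+ 2 <= expR (x / 2) ^+ 2 by rewrite lerXn2r ?nnegrE//; lra.
by rewrite expr_div_n; lra.
Qed.

(** The quadratic remainder is absorbed in one exponential that does not
    depend on [th], so that its mean is a constant while [th] tends to 0. *)
Lemma expR_scaled (th th0 y t : R) : 0 < th -> th <= th0 -> `|y| <= t ->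
  expR (th * y) <= 1 + th * y + 4 * (th / th0) ^+ 2 * expR (2 * th0 * t).
Proof.
move=> h0 h1 yt; apply: le_trans (expR_taylor _) _; rewrite lerD2l.
have th00 : 0 < th0 by lra.
have t0 : 0 <= t by apply: le_trans yt.
have -> : (th * y) ^+ 2 = (th / th0) ^+ 2 * (th0 * y) ^+ 2.
  by rewrite -exprMn mulrA divfK// gt_eqF.
have -> : 4 * (th / th0) ^+ 2 * expR (2 * th0 * t) =
    (th / th0) ^+ 2 * (4 * expR (th0 * t) * expR (th0 * t)).
  have -> : 2 * th0 * t = th0 * t + th0 * t by ring.
  by rewrite expRD; ring.
rewrite -mulrA ler_wpM2l ?sqr_ge0//.
have tt : 0 <= th0 * t by rewrite mulr_ge0// ltW.
apply: ler_pM; rewrite ?sqr_ge0 ?expR_ge0//.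
  apply: le_trans (sqr_le_expR tt).
  rewrite -real_normK ?num_real// lerXn2r ?nnegrE//.
  by rewrite normrM (gtr0_norm th00) ler_wpM2l// ltW.
by rewrite ler_expR normrM gtr0_norm// ler_pM// ltW.
Qed.

End ExpBounds.

Section Blocks.
Context (R : realType).

Definition block K (vs : nat -> nat * R) i := mkseq (fun l => vs (i * K + l)%N) K.

Definition nth_block K i (w : seq (nat * R)) := take K (drop (i * K) w).

Lemma nth_block_mkseq K vs i j : (i <= j)%N -> nth_block K i (mkseq vs (j.+1 * K)) = block K vs i.
Proof.
move=> ij; have le : (i * K + K <= j.+1 * K)%N by rewrite addnC -mulSn leq_mul2r ltnS ij orbT.
have le' := leq_trans (leq_addr _ _) le.
apply: (@eq_from_nth _ (0%N, 0)).
  rewrite size_takel ?size_mkseq// size_drop size_mkseq; lia.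
move=> l; rewrite size_takel; last by rewrite size_drop size_mkseq; lia.
by move=> lK; rewrite nth_take// nth_drop !nth_mkseq//; lia.
Qed.

End Blocks.

Section Chernoff.
Context (R : realType) (beta : R) (m : nat).
Context {hb : expanding beta m}.
Context (a b : R) (S : nat -> seq (nat * R)).
Hypotheses (ab : a < b) (fS : filling beta m a b S a b).
Local Notation wmean := (wmean beta S).
Local Notation len := (len beta).
Local Notation word := (word S).

(** Integrating [expR_scaled] gives the mean [1 - th (m2 - m1) + O(th^2)], which
    is less than 1 for small [th]. *)
Lemma chernoff K (f1 f2 : seq (nat * R) -> R) (C m1 m2 : R) :
  0 < C -> (forall w, 0 <= f1 w) -> (forall w, 0 <= f2 w) ->
  (forall w, size w = K -> word w -> `|f1 w - f2 w| <= C * (len w)%:R) ->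
  wmean K (fun w => (f1 w)%:E) = m1%:E -> wmean K (fun w => (f2 w)%:E) = m2%:E -> m1 < m2 ->
  exists th r c : R, [/\ 0 < th, 0 <= r < 1,
    (wmean K (fun w => (expR (th * (f1 w - f2 w)))%:E) <= r%:E)%E &
    (wmean K (fun w => (expR (th * (C * (len w)%:R)))%:E) <= c%:E)%E].
Proof.
move=> C0 f10 f20 fC E1 E2 m12.
have [z z1 zf] := wmean_moment fS.
have lz : 0 < ln z by rewrite ln_gt0.
(* With this scale the remainder of expR_scaled is exactly z ^+ len w. *)
pose th0 := ln z / (2 * C); have th00 : 0 < th0 by rewrite divr_gt0// mulr_gt0.
have zE w : expR (2 * th0 * (C * (len w)%:R)) = z ^+ len w.
  have -> : 2 * th0 * (C * (len w)%:R) = ln z *+ len w.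
    by rewrite -[RHS]mulr_natr /th0; field; rewrite gt_eqF.
  by rewrite -lnXn ?lnK// ?posrE ?exprn_gt0//; lra.
have z0 w : (0 <= (z ^+ len w)%:E)%E by rewrite lee_fin exprn_ge0//; lra.
have fin : wmean K (fun w => (z ^+ len w)%:E) \is a fin_num by rewrite ge0_fin_numE// wmean_ge0.
pose G := fine (wmean K (fun w => (z ^+ len w)%:E)).
have GE : wmean K (fun w => (z ^+ len w)%:E) = G%:E by rewrite fineK.
have G0 : 0 <= G by rewrite fine_ge0// wmean_ge0.
pose H := 4 / th0 ^+ 2 * G.
have H0 : 0 <= H by rewrite mulr_ge0// divr_ge0// sqr_ge0.
have key th : 0 < th -> th <= th0 ->
    (wmean K (fun w => (expR (th * (f1 w - f2 w)))%:E) <=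
     (1 - th * (m2 - m1) + th ^+ 2 * H)%:E)%E.
  move=> h0 h1.
  have e0 w : (0 <= (expR (th * (f1 w - f2 w)))%:E)%E by rewrite lee_fin expR_ge0.
  have t2 w : (0 <= th%:E * (f2 w)%:E)%E by rewrite mule_ge0// lee_fin// ltW.
  have t1 w : (0 <= th%:E * (f1 w)%:E)%E by rewrite mule_ge0// lee_fin// ltW.
  pose q := 4 * (th / th0) ^+ 2.
  have q0 : 0 <= q by rewrite mulr_ge0// sqr_ge0.
  have tq w : (0 <= q%:E * (z ^+ len w)%:E)%E by rewrite mule_ge0// lee_fin.
  have : (wmean K (fun w => (expR (th * (f1 w - f2 w)))%:E + th%:E * (f2 w)%:E) <=
      wmean K (fun w => (1 + th%:E * (f1 w)%:E) + q%:E * (z ^+ len w)%:E))%E.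
    apply: wmean_le => [w|w sw ww]; first exact: adde_ge0.
    rewrite -!EFinM -!EFinD lee_fin.
    have := expR_scaled h0 h1 (fC _ sw ww); rewrite zE -/q; lra.
  have p1 w : (0 <= 1 + th%:E * (f1 w)%:E)%E by rewrite adde_ge0.
  have p2 w : (0 <= (f1 w)%:E)%E by rewrite lee_fin.
  have p3 w : (0 <= (f2 w)%:E)%E by rewrite lee_fin.
  rewrite !wmeanD// !wmeanZ//.
  rewrite (wmean1 ab fS) E1 E2 GE -!EFinM -!EFinD -leeBrDr// -EFinB => h.
  apply: le_trans h _; rewrite lee_fin /H /q expr_div_n.
  by rewrite le_eqVlt; apply/orP; left; apply/eqP; ring.
(* The second bound gives th ^+ 2 * H <= th * (m2 - m1) / 2. *)
pose th := Num.min th0 ((m2 - m1) / (2 * (H + 1))).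
have d0 : 0 < m2 - m1 by lra.
have th_gt0 : 0 < th by rewrite lt_min th00 divr_gt0// mulr_gt0//; lra.
have th_le : th <= th0 by rewrite ge_min lexx.
have thH : th * (2 * (H + 1)) <= m2 - m1.
  by rewrite -ler_pdivlMr ?mulr_gt0//; [rewrite ge_min lexx orbT|lra].
pose r := 1 - th * (m2 - m1) + th ^+ 2 * H.
exists th, r, G; split => //.
- have r0 : 0 <= r.
    rewrite -lee_fin; apply: le_trans (key th th_gt0 th_le).
    by apply: wmean_ge0 => w; rewrite lee_fin expR_ge0.
  rewrite r0 /= /r; have := ler_wpM2l (ltW th_gt0) thH; nra.
- exact: key.
- rewrite -GE; apply: wmean_le => [w|w sw ww]; first by rewrite lee_fin expR_ge0.
  rewrite lee_fin -zE ler_expR ler_wpM2r//.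
    by rewrite mulr_ge0// ltW.
  by lra.
Qed.

Context (K : nat) (Psi : seq (nat * R) -> R) (C th : R).

(** The sum of [Psi] over the first [j] blocks plus a penalty for the length of
    the next one, which will control the times strictly between blocks. *)
Definition excess j w : R :=
  \sum_(i < j) Psi (nth_block K i w) + C * (len (nth_block K j w))%:R.

Lemma excess_cat j u w : size u = K -> excess j.+1 (u ++ w) = Psi u + excess j w.
Proof.
move=> su; rewrite /excess big_ord_recl addrA; congr (_ + _ + _).
- by rewrite /nth_block mul0n drop0 take_size_cat.
- apply: eq_bigr => i _; congr Psi.
  by rewrite /nth_block /= /bump /= add1n mulSn -su drop_cat ltnNge leq_addr /= addKn.
- by rewrite /nth_block mulSn -su drop_cat ltnNge leq_addr /= addKn.
Qed.

(** Independence of the blocks. *)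
Lemma wmean_excess r c j : 0 <= r ->
  (wmean K (fun w => (expR (th * Psi w))%:E) <= r%:E)%E ->
  (wmean K (fun w => (expR (th * (C * (len w)%:R)))%:E) <= c%:E)%E ->
  (wmean (j.+1 * K) (fun w => (expR (th * excess j w))%:E) <= (c * r ^+ j)%:E)%E.
Proof.
move=> r0 hr hc.
have e0 (x : R) : (0 <= (expR x)%:E)%E by rewrite lee_fin expR_ge0.
have c0 : 0 <= c by rewrite -lee_fin; apply: le_trans hc; apply: wmean_ge0 => w; exact: e0.
elim: j => [|j IH].
  rewrite mul1n expr0 mulr1; apply: le_trans hc; apply: wmean_le => [w|w sw ww]; first exact: e0.
  by rewrite /excess big_ord0 add0r /nth_block mul0n drop0 -sw take_size.
rewrite mulSn wmean_cat.
apply: (@le_trans _ _ (wmean K (fun u => (c * r ^+ j)%:E * (expR (th * Psi u))%:E)%E)).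
  apply: wmean_le => [u|u su wu]; first by apply: wmean_ge0 => w; exact: e0.
  apply: (@le_trans _ _ (wmean (j.+1 * K)
      (fun w => (expR (th * Psi u))%:E * (expR (th * excess j w))%:E)%E)).
    apply: wmean_le => [w|w sw ww]; first exact: e0.
    by rewrite excess_cat// mulrDr expRD EFinM.
  by rewrite wmeanZ// muleC lee_wpmul2r.
rewrite wmeanZ//; apply: (@le_trans _ _ ((c * r ^+ j)%:E * r%:E)%E).
  by rewrite lee_wpmul2l// lee_fin mulr_ge0// exprn_ge0.
by rewrite -EFinM lee_fin -mulrA -exprSr.
Qed.

End Chernoff.

Section LargeDeviations.
Context (R : realType) (beta : R) (m : nat).
Context {hb : expanding beta m}.
Context (a b : R) (S : nat -> seq (nat * R)).
Hypotheses (ab : a < b) (fS : filling beta m a b S a b).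
Local Notation wmean := (wmean beta S).
Local Notation len := (len beta).
Local Notation word := (word S).

(** Sums of independent variables of negative mean are eventually negative,
    even after adding the penalty: the probability of the contrary decays
    geometrically by [wmean_excess] and Markov's inequality. *)
Lemma block_sums_ae K (f1 f2 : seq (nat * R) -> R) (C m1 m2 : R) (c : nat * R) :
  0 < C -> (forall w, 0 <= f1 w) -> (forall w, 0 <= f2 w) ->
  (forall w, size w = K -> word w -> `|f1 w - f2 w| <= C * (len w)%:R) ->
  wmean K (fun w => (f1 w)%:E) = m1%:E -> wmean K (fun w => (f2 w)%:E) = m2%:E -> m1 < m2 ->
  lam [set x | exists y vs ys, [/\ x = bapp beta c y, itinerary beta a b S y vs ys &
    forall n, exists2 j, (n <= j)%N &
      0 < \sum_(i < j) (f1 (block K vs i) - f2 (block K vs i))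
          + C * (len (block K vs j))%:R]] = 0%E.
Proof.
move=> C0 f10 f20 fC E1 E2 m12.
have [th [r [d [th0 r01 hr hd]]]] := chernoff ab fS C0 f10 f20 fC E1 E2 m12.
pose Psi w := f1 w - f2 w.
pose Z j := [set x | exists w, [/\ size w = (j.+1 * K)%N, word w,
  0 < excess beta K Psi C j w & cell beta a b (bcomp beta c (wbranch beta w)) x]].
have Zj j : (lam (Z j) <= ((b - a) * beta ^- c.1 * d * r ^+ j)%:E)%E.
  pose B w := 0 < excess beta K Psi C j w.
  pose g w := (expR (th * excess beta K Psi C j w))%:E.
  have g0 w : (0 <= g w)%E by rewrite lee_fin expR_ge0.
  have Bg w : size w = (j.+1 * K)%N -> word w -> B w -> (1 <= g w)%E.
    by move=> _ _ e0; rewrite lee_fin -expR0 ler_expR mulr_ge0// ltW.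
  apply: le_trans (lam_words (B := B) ab c g0 Bg) _.
  have r0 : 0 <= r by case/andP: r01.
  rewrite -mulrA [leRHS]EFinM lee_wpmul2l//.
    by rewrite lee_fin mulr_ge0// ?subr_ge0 ltW// (@prob_gt0 _ _ m).
  exact: wmean_excess.
apply: lam0_sub (lam_limsup r01 Zj) => x [y [vs [ys [-> it h]]]] n.
have [j nj e0] := h n; exists j => //; exists (mkseq vs (j.+1 * K)); split.
- by rewrite size_mkseq.
- exact: mkseq_word it.
- rewrite /excess nth_block_mkseq//.
  rewrite (eq_bigr (fun i : 'I_j => Psi (block K vs i)))// => i _.
  by rewrite nth_block_mkseq// ltnW.
- exists (ys (j.+1 * K)%N); first by have [_ /(_ (j.+1 * K)%N)[]] := it.
  by rewrite bapp_comp -(itinerary_app _ it).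
Qed.

End LargeDeviations.

(** * The growth rate of the number of residuals *)

Section Rates.
Context (R : realType) (beta : R) (m : nat).
Context {hb : expanding beta m}.
Local Notation residuals := (@residuals R beta m).
Local Notation inI := (@inI R beta m).
Local Notation top := (top beta m).

Definition ln_count n x : R := ln (size (residuals n x))%:R.

Lemma ln_nat_ge0 k : 0 <= ln k%:R :> R.
Proof.
by case: k => [|k]; [rewrite ln0|rewrite ln_ge0// -[1]/(1%:R) ler_nat].
Qed.

Lemma ln_nat_le k l : (k <= l)%N -> ln k%:R <= ln l%:R :> R.
Proof.
case: k => [|k] kl; first by rewrite ln0// ln_nat_ge0.
by rewrite ler_ln ?posrE ?ltr0n ?ler_nat// (leq_trans _ kl).
Qed.

Lemma ln_count_ge0 n x : 0 <= ln_count n x. Proof. exact: ln_nat_ge0. Qed.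

Lemma m_gt1 : (1 < m)%N.
Proof. by rewrite -(ltr_nat R); apply: lt_trans base_gt1 base_lt. Qed.

Lemma lnm_gt0 : 0 < ln m%:R :> R.
Proof. by rewrite ln_gt0// -[1]/(1%:R) ltr_nat m_gt1. Qed.

Lemma ln_mexp n : ln (m ^ n)%:R = n%:R * ln m%:R :> R.
Proof.
by rewrite natrX lnXn ?ltr0n ?(ltn_trans _ m_gt1)// mulr_natl.
Qed.

Lemma ln_count_le n x : ln_count n x <= n%:R * ln m%:R.
Proof. by rewrite -ln_mexp; apply: ln_nat_le; exact: size_res_le. Qed.

Lemma ln_count_mono n k x : (n <= k)%N -> ln_count n x <= ln_count k x.
Proof. by move=> nk; apply: ln_nat_le; rewrite -(subnKC nk); exact: size_res_mono. Qed.

(** Multiplied by [n], this avoids the division by 0 and makes bounded errors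
    easy to absorb. *)
Definition has_rate (f : nat -> R) (g : R) := forall e, 0 < e ->
  exists n0, forall n, (n0 <= n)%N -> (g - e) * n%:R <= f n <= (g + e) * n%:R.

Lemma has_rate_cvg f g : has_rate f g -> f n / n%:R @[n --> \oo] --> g.
Proof.
move=> h; apply/cvgrPdist_le => e e0; have [n0 hn] := h e e0.
exists n0.+1 => // n n0n.
have n_gt0 : 0 < n%:R :> R by rewrite ltr0n (leq_ltn_trans _ n0n).
have /andP[h1 h2] := hn n (ltnW n0n).
rewrite distrC ler_distl; apply/andP; split.
  by rewrite ler_pdivlMr.
by rewrite ler_pdivrMr.
Qed.

Lemma has_rate_shift f1 f2 g k (D : R) : 0 <= g -> has_rate f2 g ->
  (forall i, `|f1 (k + i)%N - f2 i| <= D) -> has_rate f1 g.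
Proof.
move=> g0 h fD e e0; have [|n0 hn] := h (e / 2); first lra.
have D0 : 0 <= D by apply: le_trans (fD 0%N).
have [M hM] : exists M : nat, D + g * k%:R <= e / 2 * M%:R.
  exists (Num.bound ((D + g * k%:R) / (e / 2))).
  have e2 : 0 < e / 2 by lra.
  have gk : 0 <= g * k%:R by rewrite mulr_ge0.
  rewrite -ler_pdivrMl// [leLHS]mulrC ltW// archi_boundP// divr_ge0 ?addr_ge0//.
  exact: ltW.
exists (k + maxn n0 M)%N => n kn.
have [i ni] : exists i, n = (k + i)%N by exists (n - k)%N; lia.
subst n.
have [/hn/andP[h1 h2] Mi] : (n0 <= i)%N /\ (M <= i)%N by lia.
have Mi' : e / 2 * M%:R <= e / 2 * i%:R by rewrite ler_wpM2l ?ler_nat//; lra.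
have := fD i; rewrite ler_norml => /andP[h3 h4]; rewrite natrD.
have ek : 0 <= e * k%:R by rewrite mulr_ge0// ltW.
have gk : 0 <= g * k%:R by rewrite mulr_ge0.
by apply/andP; split; lra.
Qed.

Context (V : seq R).
Hypothesis hV : forall x n r r', r \in residuals n x -> r' \in residuals n x -> r' - r \in V.
Context (a b : R) (t i0 : nat).
Hypotheses (a0 : 0 < a) (ab : a < b) (bt : b < top).
Hypothesis hab : settled beta m V a b t.
Hypothesis large : forall y, a < y < b -> (2 * m ^ t <= size (residuals i0 y))%N.
Context (S : nat -> seq (nat * R)).
Hypothesis fS : filling beta m a b S a b.

Local Notation wmean := (wmean beta S).
Local Notation len := (len beta).
Local Notation word := (word S).
Local Notation wbranch := (wbranch beta).
Local Notation slack := (t%:R * ln m%:R : R).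

Lemma slack_ge0 : 0 <= slack. Proof. by rewrite mulr_ge0// ltW// lnm_gt0. Qed.

Lemma itv_inI y : a < y < b -> inI y.
Proof. by case/andP => y1 y2; rewrite /inI (lt_trans a0 y1) (lt_trans y2 bt). Qed.

Lemma ln_count_mul x n r i : r \in residuals n x -> a < r < b ->
  `|ln_count (n + i) x - (ln_count n x + ln_count i r)| <= slack.
Proof.
move=> rx rab; have [h1 h2] := size_res_quasi_mul hV hab i rx rab.
have p1 : (0 < size (residuals n x))%N by rewrite size_res_gt0// (res_inI rx).
have p2 : (0 < size (residuals i r))%N by rewrite size_res_gt0// itv_inI.
have p3 : (0 < size (residuals (n + i) x))%N by rewrite size_res_gt0// (res_inI rx).
have pm : (0 < m ^ t)%N by rewrite expn_gt0 (ltn_trans _ m_gt1).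
move: (ln_nat_le h1) (ln_nat_le h2).
rewrite !natrM !lnM ?posrE ?mulr_gt0 ?ltr0n// ln_mexp /ln_count => h3 h4.
by rewrite ler_norml; apply/andP; split; lra.
Qed.

Lemma word_itv w y : word w -> a < y < b -> a < bapp beta (wbranch w) y < b.
Proof.
elim: w => [|v w IH].
  by move=> _; rewrite /wbranch /= /bapp /= expr0 invr1 mul1r addr0.
move=> /word_cons[[d vd] ww] yab; rewrite /wbranch /= bapp_comp.
have /andP[h1 h2] := IH ww yab; have [h3 h4] := filling_sub fS vd.
have k1 : bapp beta v a < bapp beta v (bapp beta (wbranch w) y) by apply: bapp_lt.
have k2 : bapp beta v (bapp beta (wbranch w) y) < bapp beta v b by apply: bapp_lt.
by apply/andP; split; [exact: lt_trans h3 k1|exact: lt_trans k2 h4].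
Qed.

Lemma word_res w y : word w -> a < y < b -> y \in residuals (len w) (bapp beta (wbranch w) y).
Proof. by move=> /(wbranch_branch fS) h /itv_inI; exact: h. Qed.

Definition mid : R := (a + b) / 2.

Lemma mid_in : a < mid < b.
Proof. by move: (ab) => ab'; rewrite /mid; apply/andP; split; lra. Qed.

(** By [size_res_const] the point [mid] may be replaced by any point of
    ]a, b[, so this only depends on the word. *)
Definition log_count w : R := ln_count (len w) (bapp beta (wbranch w) mid).

Lemma log_count_ge0 w : 0 <= log_count w. Proof. exact: ln_count_ge0. Qed.

Lemma log_count_le w : log_count w <= (len w)%:R * ln m%:R. Proof. exact: ln_count_le. Qed.

Lemma log_countE w y : word w -> a < y < b ->
  ln_count (len w) (bapp beta (wbranch w) y) = log_count w.
Proof.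
move=> ww yab; have br : is_branch beta m (wbranch w) by exact: (wbranch_branch fS ww).
by apply: le_anti; rewrite !ln_nat_le// (size_res_const hV a0 bt hab br)// mid_in.
Qed.

Lemma log_count_cat u w : word u -> word w ->
  `|log_count (u ++ w) - (log_count u + log_count w)| <= slack.
Proof.
move=> wu ww; rewrite {1}/log_count len_cat wbranch_cat bapp_comp.
have wm := word_itv ww mid_in.
by rewrite -(log_countE wu wm); apply: ln_count_mul => //; exact: word_res.
Qed.

Lemma log_count_cat_le u w : word u -> word w ->
  log_count (u ++ w) <= log_count u + (log_count w + slack).
Proof.
move=> wu ww; have := log_count_cat wu ww; rewrite ler_norml => /andP[_].
by rewrite lerBlDr addrC addrA.
Qed.

Lemma log_count_cat_ge u w : word u -> word w ->
  log_count u + log_count w <= log_count (u ++ w) + slack.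
Proof.
move=> wu ww; have := log_count_cat wu ww.
by rewrite ler_norml lerBrDr addrC lerBlDr => /andP[].
Qed.

Lemma log_count_nil : log_count [::] = 0.
Proof.
rewrite /log_count /ln_count /= /bapp /= expr0 invr1 mul1r addr0.
by rewrite itv_inI ?mid_in//= ln1.
Qed.

(** By [size_res_double] the count doubles within [i0] steps, and each letter
    takes at least one. *)
Lemma log_count_grow k w : size w = (k * i0)%N -> word w -> k%:R * ln 2 <= log_count w.
Proof.
elim: k w => [|k IH] w; first by rewrite mul0r log_count_ge0.
rewrite mulSn addnC => sw; rewrite -(cat_take_drop (k * i0) w) => /word_cat[w1 w2].
set u := take _ w in w1 *; set v := drop _ w in w2 *.
have su : size u = (k * i0)%N by rewrite size_takel// sw leq_addr.
have sv : size v = i0 by rewrite size_drop sw addKn.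
have vm := word_itv w2 mid_in.
set x := bapp beta (wbranch u) (bapp beta (wbranch v) mid).
have h : (2 * size (residuals (len u) x) <= size (residuals (len u + i0) x))%N.
  exact: (size_res_double hV hab large (word_res w1 vm) vm).
have lv : (len u + i0 <= len u + len v)%N by rewrite leq_add2l -sv (size_le_len fS).
have p1 : (0 < size (residuals (len u) x))%N.
  by apply: size_res_gt0; apply: res_inI (word_res w1 vm).
apply: (@le_trans _ _ (ln_count (len u + i0)%N x)); last first.
  by rewrite /log_count len_cat wbranch_cat bapp_comp; exact: ln_count_mono.
apply: le_trans (ln_nat_le h); rewrite natrM lnM ?posrE ?ltr0n//.
rewrite -[ln (size _)%:R]/(ln_count _ _) (log_countE w1 vm) -natr1 mulrDl mul1r addrC lerD2l.
exact: IH.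
Qed.

Lemma wmean_len_fin K : wmean K (fun w => ((len w)%:R)%:E) \is a fin_num.
Proof.
rewrite ge0_fin_numE; last by apply: wmean_ge0 => w; rewrite lee_fin.
have [z z1 zf] := wmean_moment fS; have lz : 0 < ln z by rewrite ln_gt0.
have z0 w : (0 <= (z ^+ len w)%:E)%E by rewrite lee_fin exprn_ge0//; lra.
apply: le_lt_trans (_ : ((ln z)^-1%:E * wmean K (fun w => (z ^+ len w)%:E) < +oo)%E).
  rewrite -wmeanZ//; apply: wmean_le => [w|w _ _]; first by rewrite lee_fin.
  rewrite -EFinM lee_fin mulrC ler_pdivlMr// mulr_natl.
  have zn : 0 < z ^+ len w by rewrite exprn_gt0//; lra.
  have -> : z ^+ len w = expR (ln z *+ len w) by rewrite -lnXn ?lnK ?posrE//; lra.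
  by have := expR_ge1Dx (ln z *+ len w); lra.
by apply: lte_mul_pinfty => //; rewrite lee_fin invr_ge0 ltW.
Qed.

Definition mean_len : R := fine (wmean 1 (fun w => ((len w)%:R)%:E)).

Lemma wmean_len K : wmean K (fun w => ((len w)%:R)%:E) = (K%:R * mean_len)%:E.
Proof.
elim: K => [|K IH]; first by rewrite /= /len /wbranch /= mul0r.
have n0 w : (0 <= ((len w)%:R)%:E :> \bar R)%E by rewrite lee_fin.
have T1 : wmean 1 (fun w => ((len w)%:R)%:E) = mean_len%:E by rewrite fineK// wmean_len_fin.
have KT0 : (0 <= (K%:R * mean_len)%:E)%E by rewrite -IH; exact: wmean_ge0.
rewrite -add1n wmean_cat.
transitivity (wmean 1 (fun u => ((len u)%:R)%:E + (K%:R * mean_len)%:E)%E).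
  congr wmean; apply/funext => u.
  rewrite -IH -(wmean_cst ab fS K (len u)%:R) -wmeanD//; congr wmean; apply/funext => w.
  by rewrite len_cat natrD EFinD.
by rewrite wmeanD// T1 (wmean_cst ab fS) -EFinD natrD mulrDl mul1r.
Qed.

Lemma mean_len_ge1 : 1 <= mean_len.
Proof.
rewrite -lee_fin -[mean_len]mul1r -(wmean_len 1) -(wmean1 ab fS 1).
apply: wmean_le => // w sw ww; rewrite lee_fin -[1]/(1%:R) ler_nat -sw.
exact: (size_le_len fS).
Qed.

Definition mean_log K : R := fine (wmean K (fun w => (log_count w)%:E)).

Lemma mean_logE K : wmean K (fun w => (log_count w)%:E) = (mean_log K)%:E.
Proof.
have h0 w : (0 <= (log_count w)%:E)%E by rewrite lee_fin log_count_ge0.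
rewrite fineK// ge0_fin_numE ?wmean_ge0//.
apply: le_lt_trans (_ : ((ln m%:R)%:E * wmean K (fun w => ((len w)%:R)%:E) < +oo)%E).
  rewrite -wmeanZ; last by move=> w; rewrite lee_fin.
  by apply: wmean_le => // w _ _; rewrite -EFinM lee_fin mulrC log_count_le.
by rewrite wmean_len -EFinM ltry.
Qed.

Lemma mean_log_ge0 K : 0 <= mean_log K.
Proof. by rewrite -lee_fin -mean_logE wmean_ge0// => w; rewrite lee_fin log_count_ge0. Qed.

Lemma mean_log_cat_le K L : mean_log (K + L) <= mean_log K + mean_log L + slack.
Proof.
have h0 w : (0 <= (log_count w)%:E)%E by rewrite lee_fin log_count_ge0.
have c0 := slack_ge0; have L0 := mean_log_ge0 L.
rewrite -lee_fin -mean_logE wmean_cat.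
apply: (@le_trans _ _ (wmean K (fun u => (log_count u)%:E + (mean_log L + slack)%:E)%E)); last first.
  rewrite wmeanD//; last by move=> _; rewrite lee_fin addr_ge0.
  by rewrite mean_logE (wmean_cst ab fS) -EFinD addrA.
apply: wmean_le => [u|u _ wu]; first exact: wmean_ge0.
rewrite [X in (_ + X)%E]EFinD -mean_logE -(wmean_cst ab fS L slack).
rewrite -(wmean_cst ab fS L (log_count u)) -wmeanD// -?wmeanD//.
- apply: wmean_le => [w|w _ ww]; first exact: h0.
  by rewrite -!EFinD lee_fin log_count_cat_le.
- by move=> w; rewrite adde_ge0// lee_fin.
Qed.

Lemma mean_log_cat_ge K L : mean_log K + mean_log L <= mean_log (K + L) + slack.
Proof.
have h0 w : (0 <= (log_count w)%:E)%E by rewrite lee_fin log_count_ge0.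
have c0 := slack_ge0; have L0 := mean_log_ge0 L.
have cE (w : seq (nat * R)) : (0 <= slack%:E)%E by rewrite lee_fin.
rewrite -lee_fin [leRHS]EFinD -mean_logE wmean_cat.
apply: (@le_trans _ _ (wmean K (fun u => (log_count u)%:E + (mean_log L)%:E)%E)).
  by rewrite wmeanD// ?mean_logE ?(wmean_cst ab fS) -?EFinD// => _; rewrite lee_fin.
rewrite -(wmean_cst ab fS K slack) -wmeanD//; last by move=> u; apply: wmean_ge0.
apply: wmean_le => [u|u _ wu]; first by rewrite adde_ge0// lee_fin.
rewrite -mean_logE -(wmean_cst ab fS L (log_count u)) -(wmean_cst ab fS L slack) -wmeanD// -wmeanD//.
apply: wmean_le => [w|w _ ww]; first by rewrite adde_ge0.
by rewrite -!EFinD lee_fin log_count_cat_ge.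
Qed.

Lemma mean_log_mul n K :
  n%:R * (mean_log K - slack) <= mean_log (n * K) <= n%:R * (mean_log K + slack).
Proof.
elim: n => [|n /andP[IH1 IH2]].
  have -> : mean_log (0 * K) = 0 by rewrite /mean_log /= log_count_nil.
  by rewrite !mul0r lexx.
have := mean_log_cat_le K (n * K); have := mean_log_cat_ge K (n * K).
by rewrite -mulSn -natr1 !mulrDl !mul1r => h1 h2; apply/andP; split; lra.
Qed.

(** Bound [mean_log (K * L)] through [K] words of length [L], or the converse. *)
Lemma mean_log_cmp K L : (0 < K)%N -> (0 < L)%N ->
  (mean_log K - slack) / K%:R <= (mean_log L + slack) / L%:R.
Proof.
move=> K0 L0; have /andP[h1 _] := mean_log_mul L K; have /andP[_ h2] := mean_log_mul K L.
rewrite ler_pdivrMr ?ltr0n// mulrAC ler_pdivlMr ?ltr0n//.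
by rewrite mulrC [X in _ <= X]mulrC; apply: le_trans h1 _; rewrite mulnC.
Qed.

(** [mean_log] is additive up to [slack], so that [mean_log K / K] converges
    with error [slack / K]; [log_count_grow] makes the limit positive. *)
Lemma rate_ex : exists2 g : R, 0 < g &
  forall K, mean_log K - slack <= g * (K%:R * mean_len) <= mean_log K + slack.
Proof.
have T1 := mean_len_ge1; have c0 := slack_ge0; have T0 : 0 < mean_len by lra.
pose A := [set (mean_log K - slack) / K%:R | K in [set K | (0 < K)%N]].
have A0 : A !=set0 by exists ((mean_log 1 - slack) / 1%:R), 1%N.
have Aub L : (0 < L)%N -> ubound A ((mean_log L + slack) / L%:R).
  by move=> L0 _ [K /= K0 <-]; exact: mean_log_cmp.
have supA : has_sup A by split => //; exists ((mean_log 1 + slack) / 1%:R); exact: Aub.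
exists (sup A / mean_len); last first.
  case=> [|K].
    by rewrite mul0r mulr0 /mean_log /= log_count_nil; apply/andP; split; lra.
  have Kp : 0 < K.+1%:R :> R by [].
  have -> : sup A / mean_len * (K.+1%:R * mean_len) = sup A * K.+1%:R.
    by rewrite mulrCA divfK ?gt_eqF// mulrC.
  apply/andP; split.
    by rewrite -ler_pdivrMr//; apply: (ub_le_sup supA.2); exists K.+1.
  by rewrite -ler_pdivlMr//; apply: ge_sup => //; exact: Aub.
apply: divr_gt0 => //.
have l2 : 0 < ln 2 :> R by rewrite ln_gt0// ltr1n.
(* After k doublings the logarithm of the count exceeds the slack. *)
have [k hk] : exists k : nat, slack < k%:R * ln 2.
  exists (Num.bound (slack / ln 2)); rewrite -ltr_pdivrMr//.
  by apply: archi_boundP; rewrite divr_ge0// ltW.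
have ek : k%:R * ln 2 <= mean_log (k * i0).
  rewrite -lee_fin -mean_logE -(wmean_cst ab fS (k * i0)).
  apply: wmean_le => [w|w sw ww]; first by rewrite lee_fin; lra.
  by rewrite lee_fin; exact: log_count_grow.
have K0 : (0 < k * i0)%N.
  rewrite lt0n; apply/eqP => K0; move: ek; rewrite K0 /mean_log /= log_count_nil; lra.
apply: (@lt_le_trans _ _ ((mean_log (k * i0) - slack) / (k * i0)%:R)).
  by rewrite divr_gt0 ?ltr0n//; lra.
by apply: (ub_le_sup supA.2); exists (k * i0)%N.
Qed.

Lemma mkseq_blocks (vs : nat -> nat * R) K j :
  mkseq vs (j.+1 * K) = mkseq vs (j * K) ++ block K vs j.
Proof.
rewrite mulSn addnC /mkseq iotaD map_cat; congr cat.
by rewrite add0n -[X in iota X]addn0 iotaDl -map_comp.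
Qed.

Lemma block_word y vs ys K j : itinerary beta a b S y vs ys -> word (block K vs j).
Proof. by move=> [_ h] v /mapP[l _ ->]; have [] := h (j * K + l)%N. Qed.

Lemma len_blocks (vs : nat -> nat * R) K j :
  ((len (mkseq vs (j * K)))%:R = \sum_(i < j) (len (block K vs i))%:R :> R).
Proof.
elim: j => [|j IH]; first by rewrite big_ord0 mul0n.
by rewrite big_ord_recr /= mkseq_blocks len_cat natrD IH.
Qed.

Lemma log_count_blocks_le y vs ys K j : itinerary beta a b S y vs ys ->
  log_count (mkseq vs (j * K)) <= \sum_(i < j) (log_count (block K vs i) + slack).
Proof.
move=> it; elim: j => [|j IH]; first by rewrite big_ord0 mul0n log_count_nil.
rewrite big_ord_recr /= mkseq_blocks.
apply: le_trans (log_count_cat_le (mkseq_word it) (block_word it)) _.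
by rewrite lerD2r.
Qed.

Lemma log_count_blocks_ge y vs ys K j : itinerary beta a b S y vs ys ->
  \sum_(i < j) (log_count (block K vs i) - slack) <= log_count (mkseq vs (j * K)).
Proof.
move=> it; elim: j => [|j IH]; first by rewrite big_ord0 mul0n log_count_nil.
rewrite big_ord_recr /= mkseq_blocks addrA lerBlDr.
apply: le_trans (log_count_cat_ge (mkseq_word it) (block_word it)).
by rewrite lerD2r.
Qed.

Lemma ln_count_mkseq y vs ys k : itinerary beta a b S y vs ys ->
  ln_count (len (mkseq vs k)) y = log_count (mkseq vs k).
Proof.
move=> it; rewrite {1}(itinerary_app k it) log_countE//; first exact: mkseq_word it.
by have [_ /(_ k)[]] := it.
Qed.

Lemma block_times y vs ys K n N : (0 < K)%N -> itinerary beta a b S y vs ys ->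
  (len (mkseq vs (n * K)) <= N)%N ->
  exists2 j, (n <= j)%N & (len (mkseq vs (j * K)) <= N <= len (mkseq vs (j.+1 * K)))%N.
Proof.
move=> K0 it nN.
have bd j : (len (mkseq vs (j * K)) <= N)%N -> (j <= N)%N.
  apply: leq_trans; apply: leq_trans (size_le_len fS (mkseq_word it)).
  by rewrite size_mkseq leq_pmulr.
have ex : exists j, (len (mkseq vs (j * K)) <= N)%N by exists n.
case: (ex_maxnP ex bd) => j h1 h2; exists j; first exact: h2.
rewrite h1 /= leqNgt; apply/negP => /ltnW /h2.
by rewrite ltnn.
Qed.

Lemma slack_le_len K w : (0 < K)%N -> size w = K -> word w -> slack <= slack * (len w)%:R.
Proof.
move=> K0 sw ww; rewrite ler_peMr ?slack_ge0// -[1]/(1%:R) ler_nat.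
by apply: leq_trans (size_le_len fS ww); rewrite sw.
Qed.

Context (g : R).
Hypotheses (g0 : 0 < g).
Hypothesis hg : forall K, mean_log K - slack <= g * (K%:R * mean_len) <= mean_log K + slack.

(** The loss of [slack] on each block is negligible for large [K], since a
    block of [K] branches takes at least [K] steps on average. *)
Lemma large_block (e : R) : 0 < e -> exists2 K, (0 < K)%N & 2 * slack < e * (K%:R * mean_len).
Proof.
move=> e0; have T1 := mean_len_ge1.
have h : 0 <= 2 * slack / e.
  by apply: divr_ge0; [apply: mulr_ge0 => //; exact: slack_ge0|exact: ltW].
have := archi_boundP h; set K := Num.bound _ => hK.
exists K; first by rewrite -(ltr_nat R) (le_lt_trans h).
move: hK; rewrite ltr_pdivrMr// => /lt_le_trans; apply.
have -> : e * (K%:R * mean_len) = K%:R * e * mean_len by ring.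
by rewrite ler_peMr// mulr_ge0// ltW.
Qed.

(** Apply [block_sums_ae] to [log_count + slack - (g + e) * len] on blocks; a
    time that falls inside a block is compared with the end of that block, and
    the penalty pays for the difference. *)
Lemma rate_upper (e : R) c : 0 < e ->
  lam [set x | exists y vs ys, [/\ x = bapp beta c y, itinerary beta a b S y vs ys &
    ~ exists n0, forall n, (n0 <= n)%N -> ln_count n y <= (g + e) * n%:R]] = 0%E.
Proof.
move=> e0; have [K K0 hK] := large_block e0; have c0 := slack_ge0; have lm := lnm_gt0.
(* C bounds both f1 and f2 for each unit of length. *)
pose C := ln m%:R + slack + (g + e); have ge0 : 0 < g + e by exact: addr_gt0.
have C0 : 0 < C by rewrite /C; lra.
pose f1 w := log_count w + slack; pose f2 w : R := (g + e) * (len w)%:R.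
have l0 (w : seq (nat * R)) : 0 <= (len w)%:R :> R by [].
have f10 w : 0 <= f1 w by rewrite /f1 addr_ge0 ?log_count_ge0.
have f20 w : 0 <= f2 w by rewrite /f2 mulr_ge0// ltW.
have fC w : size w = K -> word w -> `|f1 w - f2 w| <= C * (len w)%:R.
  move=> sw ww; have h1 := slack_le_len K0 sw ww; have h2 := log_count_le w; have h3 := f20 w.
  have h4 := f10 w; rewrite /C; move: h3 h4; rewrite /f1 /f2 => h3 h4.
  have h5 : 0 <= (ln m%:R : R) * (len w)%:R by rewrite mulr_ge0// ltW.
  by rewrite ler_norml; apply/andP; split; lra.
have E1 : wmean K (fun w => (f1 w)%:E) = (mean_log K + slack)%:E.
  rewrite EFinD -mean_logE -(wmean_cst ab fS K slack) -wmeanD// => w; rewrite lee_fin//.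
  exact: log_count_ge0.
have E2 : wmean K (fun w => (f2 w)%:E) = ((g + e) * (K%:R * mean_len))%:E.
  by rewrite EFinM -wmean_len -wmeanZ// => w; rewrite lee_fin.
have m12 : mean_log K + slack < (g + e) * (K%:R * mean_len).
  by have /andP[h _] := hg K; rewrite mulrDl; lra.
apply: (lam0_sub _ (block_sums_ae ab fS c C0 f10 f20 fC E1 E2 m12)) => x.
move=> [y [vs [ys [xE it nr]]]]; exists y, vs, ys; split => // n.
apply: contrapT => nj; apply: nr; exists (len (mkseq vs (n * K))) => N nN.
have [j jn /andP[N1 N2]] := block_times K0 it nN.
have hj : \sum_(i < j) (f1 (block K vs i) - f2 (block K vs i)) +
    C * (len (block K vs j))%:R <= 0.
  by rewrite leNgt; apply/negP => h; apply: nj; exists j.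
have h1 : ln_count N y <=
    \sum_(i < j) (log_count (block K vs i) + slack) + (log_count (block K vs j) + slack).
  apply: le_trans (ln_count_mono _ N2) _; rewrite (ln_count_mkseq _ it).
  by apply: le_trans (log_count_blocks_le K j.+1 it) _; rewrite big_ord_recr.
have h2 : log_count (block K vs j) + slack <= C * (len (block K vs j))%:R.
  have sb : size (block K vs j) = K by rewrite size_mkseq.
  have := slack_le_len K0 sb (block_word it); have := log_count_le (block K vs j).
  have := f20 (block K vs j); rewrite /f2 /C; lra.
have h3 : (g + e) * (len (mkseq vs (j * K)))%:R <= (g + e) * N%:R.
  by rewrite ler_wpM2l ?ler_nat// ltW.
apply: le_trans h1 _; apply: le_trans h3.
move: hj; rewrite sumrB len_blocks mulr_sumr /f1 /f2; lra.
Qed.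

(** As for [rate_upper], with [g * len + slack - (log_count + e * len)], and a
    comparison with the beginning of the block. *)
Lemma rate_lower (e : R) c : 0 < e ->
  lam [set x | exists y vs ys, [/\ x = bapp beta c y, itinerary beta a b S y vs ys &
    ~ exists n0, forall n, (n0 <= n)%N -> (g - e) * n%:R <= ln_count n y]] = 0%E.
Proof.
move=> e0; have [K K0 hK] := large_block e0; have c0 := slack_ge0; have lm := lnm_gt0.
move: (g0) => g0'.
pose C := ln m%:R + slack + (g + e); have ge0 : 0 < g + e by exact: addr_gt0.
have C0 : 0 < C by rewrite /C; lra.
pose f1 w : R := g * (len w)%:R + slack; pose f2 w : R := log_count w + e * (len w)%:R.
have l0 (w : seq (nat * R)) : 0 <= (len w)%:R :> R by [].
have gl (w : seq (nat * R)) : 0 <= g * (len w)%:R by rewrite mulr_ge0// ltW.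
have el (w : seq (nat * R)) : 0 <= e * (len w)%:R by rewrite mulr_ge0// ltW.
have f10 w : 0 <= f1 w by rewrite /f1 addr_ge0.
have f20 w : 0 <= f2 w by rewrite /f2 addr_ge0 ?log_count_ge0.
have fC w : size w = K -> word w -> `|f1 w - f2 w| <= C * (len w)%:R.
  move=> sw ww; have h1 := slack_le_len K0 sw ww.
  have h2 := log_count_le w; have h3 := log_count_ge0 w.
  have h5 : 0 <= (ln m%:R : R) * (len w)%:R by rewrite mulr_ge0// ltW.
  have h6 := gl w; have h7 := el w; rewrite /C /f1 /f2.
  by rewrite ler_norml; apply/andP; split; lra.
have E1 : wmean K (fun w => (f1 w)%:E) = (g * (K%:R * mean_len) + slack)%:E.
  have h w : (0 <= g%:E * ((len w)%:R)%:E)%E by rewrite -EFinM lee_fin.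
  have h' w : (0 <= ((len w)%:R)%:E :> \bar R)%E by rewrite lee_fin.
  have h'' (w : seq (nat * R)) : (0 <= (slack%:E : \bar R))%E by rewrite lee_fin.
  rewrite EFinD [(g * (K%:R * mean_len))%:E]EFinM -wmean_len -wmeanZ//.
  by rewrite -(wmean_cst ab fS K slack) -wmeanD.
have E2 : wmean K (fun w => (f2 w)%:E) = (mean_log K + e * (K%:R * mean_len))%:E.
  have h w : (0 <= e%:E * ((len w)%:R)%:E)%E by rewrite -EFinM lee_fin.
  have h' w : (0 <= ((len w)%:R)%:E :> \bar R)%E by rewrite lee_fin.
  have h'' w : (0 <= (log_count w)%:E :> \bar R)%E by rewrite lee_fin log_count_ge0.
  by rewrite EFinD [(e * (K%:R * mean_len))%:E]EFinM -wmean_len -wmeanZ// -mean_logE -wmeanD.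
have m12 : g * (K%:R * mean_len) + slack < mean_log K + e * (K%:R * mean_len).
  by have /andP[_ h] := hg K; lra.
apply: (lam0_sub _ (block_sums_ae ab fS c C0 f10 f20 fC E1 E2 m12)) => x.
move=> [y [vs [ys [xE it nr]]]]; exists y, vs, ys; split => // n.
apply: contrapT => nj; apply: nr; exists (len (mkseq vs (n * K))) => N nN.
have [j jn /andP[N1 N2]] := block_times K0 it nN.
have hj : \sum_(i < j) (f1 (block K vs i) - f2 (block K vs i)) +
    C * (len (block K vs j))%:R <= 0.
  by rewrite leNgt; apply/negP => h; apply: nj; exists j.
have h1 : \sum_(i < j) (log_count (block K vs i) - slack) <= ln_count N y.
  apply: le_trans (ln_count_mono _ N1); rewrite (ln_count_mkseq _ it).
  exact: log_count_blocks_ge it.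
apply: le_trans h1.
have n1 : N%:R <= (len (mkseq vs (j * K)))%:R + (len (block K vs j))%:R :> R.
  by rewrite -natrD ler_nat -len_cat -mkseq_blocks.
have n2 : (len (mkseq vs (j * K)))%:R <= N%:R :> R by rewrite ler_nat.
have h2 : (g - e) * N%:R <= (g - e) * (len (mkseq vs (j * K)))%:R
   + C * (len (block K vs j))%:R.
  have c1 : 0 <= (C - g) * (len (block K vs j))%:R.
    by rewrite mulr_ge0// /C; lra.
  have c2 : 0 <= e * (N%:R - (len (mkseq vs (j * K)))%:R) by rewrite mulr_ge0 ?subr_ge0// ltW.
  have c3 : g * (N%:R - (len (mkseq vs (j * K)))%:R) <= g * (len (block K vs j))%:R.
    by apply: ler_wpM2l; [exact: ltW|lra].
  lra.
apply: le_trans h2 _; move: hj.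
rewrite len_blocks mulr_sumr /f1 /f2.
set A := \sum_(i < j) _; set B := \sum_(i < j) _; set D := \sum_(i < j) _.
have -> : A = B - D.
  by rewrite /A /B /D -sumrB; apply: eq_bigr => i _; ring.
lra.
Qed.

Lemma rate_ae c : lam (bapp beta c @` [set y | a < y < b /\
  ~ has_rate (fun n => ln_count n y) g]) = 0%E.
Proof.
pose e k : R := k.+1%:R^-1; have e0 k : 0 < e k by rewrite invr_gt0.
pose F1 k := [set x | exists y vs ys, [/\ x = bapp beta c y, itinerary beta a b S y vs ys &
    ~ exists n0, forall n, (n0 <= n)%N -> ln_count n y <= (g + e k) * n%:R]].
pose F2 k := [set x | exists y vs ys, [/\ x = bapp beta c y, itinerary beta a b S y vs ys &
    ~ exists n0, forall n, (n0 <= n)%N -> (g - e k) * n%:R <= ln_count n y]].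
apply: (@lam0_bigcup _ (fun k => dead beta a b S k c `|` (F1 k `|` F2 k))); last first.
  move=> k; apply: lam0U; first exact: (lam_dead fS).
  by apply: lam0U; [exact: rate_upper|exact: rate_lower].
move=> _ [y [yab nr] <-]; apply: contrapT => nk.
have nd k : ~ dead beta a b S k c (bapp beta c y).
  by move=> d; apply: nk; exists k; left.
have [vs [ys it]] := itinerary_ex yab nd.
apply: nr => d d0.
have [k hk] : exists k, e k <= d.
  exists (Num.bound d^-1); rewrite /e -[leRHS]invrK lef_pV2 ?posrE ?invr_gt0//.
  apply: ltW; apply: lt_trans (archi_boundP _) _; first by rewrite invr_ge0 ltW.
  by rewrite ltr_nat.
have [n1 h1] : exists n0, forall n, (n0 <= n)%N -> ln_count n y <= (g + e k) * n%:R.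
  by apply: contrapT => h; apply: nk; exists k; right; left; exists y, vs, ys.
have [n2 h2] : exists n0, forall n, (n0 <= n)%N -> (g - e k) * n%:R <= ln_count n y.
  by apply: contrapT => h; apply: nk; exists k; right; right; exists y, vs, ys.
exists (maxn n1 n2) => n; rewrite geq_max => /andP[/h1 h3 /h2 h4]; apply/andP; split.
  by apply: le_trans h4; rewrite ler_wpM2r// lerB.
by apply: le_trans h3 _; rewrite ler_wpM2r// lerD2l.
Qed.

Context (S0 : nat -> seq (nat * R)).
Hypothesis fS0 : filling beta m a b S0 0 top.

(** Almost every point is the image of a point of ]a, b[ under a branch [v];
    quasi-multiplicativity at time [v.1] transfers the rate. *)
Lemma rate_ae_top : lam [set x | inI x /\ ~ has_rate (fun n => ln_count n x) g] = 0%E.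
Proof.
apply: (@lam0_sub _ _ ((bapp beta (0%N, 0) @` uncovered beta a b S0 0 top) `|`
  [set x | exists d, exists2 v, v \in S0 d & (bapp beta v @` [set y | a < y < b /\
    ~ has_rate (fun n => ln_count n y) g]) x])); last first.
  apply: lam0U; first exact: (filling_null fS0).
  apply: (@lam0_layers _ _ S0 (fun v => bapp beta v @` [set y | a < y < b /\
    ~ has_rate (fun n => ln_count n y) g])) => // d v _.
  exact: rate_ae.
move=> x [/andP[x0 xt] nr].
case: (pselect (uncovered beta a b S0 0 top x)) => [u|nu].
  by left; exists x => //; rewrite /bapp /= expr0 invr1 mul1r addr0.
right; apply: contrapT => nd; apply: nu; split; first by rewrite !ltW.
move=> [d [v vd xv]]; apply: nd; exists d, v => //.
have [y yab xE] := image_itv xv; exists y => //; split => // ry; apply: nr.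
have yx : y \in residuals v.1 x by rewrite xE; apply: (filling_branch fS0 vd); exact: itv_inI.
apply: (has_rate_shift (k := v.1) (D := slack + ln_count v.1 x) _ ry); first exact: ltW.
move=> i; have := ln_count_mul i yx yab; have := ln_count_ge0 v.1 x.
by rewrite !ler_norml => ? /andP[? ?]; apply/andP; split; lra.
Qed.

End Rates.

(** * Prefixes of expansions as residuals *)

Section Expansions.
Context (R : realType) (beta : R) (m : nat).
Context {hb : expanding beta m}.
Local Notation residuals := (@residuals R beta m).
Local Notation inI := (@inI R beta m).
Local Notation top := (top beta m).

Definition residual (w : seq 'I_m) (x : R) : R := foldl (fun r (d : 'I_m) => beta * r - d%:R) x w.

Fixpoint digit_words n : seq (seq 'I_m) :=
  if n is n'.+1 then [seq d :: w | d <- enum 'I_m, w <- digit_words n'] else [:: [::]].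

Lemma mem_digit_words n w : (w \in digit_words n) = (size w == n).
Proof.
elim: n w => [|n IH] [|d w] //=.
  by apply/negP => /allpairsP[[d w] []].
rewrite eqSS -IH; apply/allpairsP/idP => [[[d' w'] /= [_ w'n [_ ->]]]//|wn].
by exists (d, w); rewrite mem_enum.
Qed.

Lemma uniq_digit_words n : uniq (digit_words n).
Proof.
elim: n => //= n IH; apply: allpairs_uniq => //; first exact: enum_uniq.
by move=> [d w] [d' w'] _ _ /= [-> ->].
Qed.

Lemma size_res_count n x :
  size (residuals n x) = count (fun w => inI (residual w x)) (digit_words n).
Proof.
elim: n x => [|n IH] x /=; first by case: ifP.
rewrite size_flatten /shape -map_comp -val_enum_ord -map_comp count_flatten -map_comp.
congr sumn; apply: eq_map => d /=.
by rewrite IH count_map; apply: eq_count => w.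
Qed.

Lemma card_tuples n (P : pred (seq 'I_m)) :
  #|[set w : n.-tuple 'I_m | P w]%SET| = count P (digit_words n).
Proof.
rewrite cardE -(size_map val) -size_filter; apply: perm_size; apply: uniq_perm.
- by rewrite map_inj_uniq ?enum_uniq//; exact: val_inj.
- by rewrite filter_uniq// uniq_digit_words.
move=> w; rewrite mem_filter mem_digit_words; apply/mapP/andP => [[u]|[Pw sw]].
  by rewrite mem_enum inE => Pu ->; rewrite size_tuple.
by exists (Tuple sw); rewrite // mem_enum inE.
Qed.

Definition partial (e : nat -> 'I_m) n : R := series (fun k => (e k)%:R * beta ^- k.+1) n.

Lemma partialS e n : partial e n.+1 = partial e n + (e n)%:R * beta ^- n.+1.
Proof. by rewrite /partial /series /= big_nat_recr. Qed.

Lemma residual_mkseqS e n x : residual (mkseq e n.+1) x = beta * residual (mkseq e n) x - (e n)%:R.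
Proof. by rewrite mkseqS /residual foldl_rcons. Qed.

Lemma expbV n : beta ^- n = beta * beta ^- n.+1.
Proof.
have b0 : beta != 0 by rewrite gt_eqF// (@beta_gt0 _ _ m).
by rewrite exprS invfM mulrA divff// mul1r.
Qed.

Lemma partialE e n x : x = partial e n + beta ^- n * residual (mkseq e n) x.
Proof.
elim: n => [|n {1}->].
  by rewrite /partial /series /= big_geq// expr0 invr1 mul1r add0r.
by rewrite partialS residual_mkseqS expbV; ring.
Qed.

(** The partial sums increase to [x], and decrease when increased by
    [beta^-k top], the largest possible tail. *)
Lemma expansion_residual e n x : is_expansion beta x e -> 0 <= residual (mkseq e n) x <= top.
Proof.
move=> ex; have bn : 0 < beta ^- n by rewrite invr_gt0 (expb_gt0 (m := m)).
have bk k : 0 < beta ^- k by rewrite invr_gt0 (expb_gt0 (m := m)).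
have lo k : partial e n <= partial e (n + k).
  elim: k => [|k IH]; first by rewrite addn0.
  by rewrite addnS partialS; apply: le_trans IH _; rewrite lerDl mulr_ge0// ltW.
have hi k : partial e (n + k) + beta ^- (n + k) * top <= partial e n + beta ^- n * top.
  elim: k => [|k IH]; first by rewrite addn0.
  apply: le_trans IH; rewrite addnS partialS [beta ^- (n + k)]expbV -addrA lerD2l.
  have tE := @topE _ _ _ hb.
  have ed : (e (n + k)%N)%:R + 1 <= m%:R :> R by rewrite natr1 ler_nat.
  have h : (e (n + k)%N)%:R + top <= beta * top by lra.
  by have := ler_wpM2l (ltW (bk (n + k).+1)) h; lra.
have cv : partial e k @[k --> \oo] --> x by [].
have h1 : partial e n <= x.
  apply: (cvgr_to_ge cv); near=> k.
  by rewrite -(@subnKC n k)//; near: k; exists n.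
have h2 : x <= partial e n + beta ^- n * top.
  apply: (cvgr_to_le cv); near=> k.
  have nk : (n <= k)%N by near: k; exists n.
  apply: le_trans (hi (k - n)%N); rewrite subnKC// lerDl mulr_ge0// ?ltW//.
  exact: top_gt0.
have xE := partialE e n x.
have h3 : 0 <= beta ^- n * residual (mkseq e n) x by lra.
have h4 : beta ^- n * residual (mkseq e n) x <= beta ^- n * top by lra.
by move: h3 h4; rewrite pmulr_rge0// ler_pM2l// => -> ->.
Unshelve. all: by end_near. Qed.

(** By [inI_step] the residual can be kept in the interval forever. *)
Lemma residual_expansion w x : inI (residual w x) ->
  exists e : nat -> 'I_m, mkseq e (size w) = w /\ is_expansion beta x e.
Proof.
move=> Iw.
have /choice[dig digP] : forall y, exists d : 'I_m, inI y -> inI (beta * y - (d : nat)%:R).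
  move=> y; case: (boolP (inI y)) => [Iy|nI].
    by have [d dm Id] := inI_step Iy; exists (Ordinal dm).
  have m0 : (0 < m)%N by apply: ltnW; exact: (m_gt1 (beta := beta)).
  by exists (Ordinal m0).
pose ys k := iter k (fun y => beta * y - (dig y : nat)%:R) (residual w x).
pose e i := if (i < size w)%N then nth (dig x) w i else dig (ys (i - size w)%N).
have ew : mkseq e (size w) = w.
  apply: (@eq_from_nth _ (dig x)); first by rewrite size_mkseq.
  by rewrite size_mkseq => i iw; rewrite nth_mkseq// /e iw.
have Iys k : inI (ys k) by elim: k => //= k; exact: digP.
have rys k : residual (mkseq e (size w + k)) x = ys k.
  elim: k => [|k IH]; first by rewrite addn0 ew.
  by rewrite addnS residual_mkseqS IH /e ltnNge leq_addr /= addKn.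
exists e; split => //.
have t0 : 0 < top by exact: top_gt0.
apply/cvgrPdist_le => d d0.
have : (fun n => top * beta^-1 ^+ n) @ \oo --> top * 0.
  apply: cvgMl_tmp; apply: cvg_expr; have b0 := @beta_gt0 _ _ _ hb.
  by rewrite gtr0_norm ?invr_gt0// invf_lt1// base_gt1.
rewrite mulr0 => /cvgr0Pnorm_lt /(_ _ d0)[n1 _ hn1].
exists (size w + n1)%N => // n /= hn.
have [k nk] : exists k, n = (size w + k)%N by exists (n - size w)%N; lia.
have n1n : (n1 <= n)%N by lia.
have bn : 0 < beta ^- n by rewrite invr_gt0 (expb_gt0 (m := m)).
have := partialE e n x; rewrite {3}nk rys => xE.
have -> : x - series (fun k => (e k)%:R * beta ^- k.+1) n = beta ^- n * ys k.
  by rewrite {1}xE /partial; ring.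
have /andP[y0 y1] := Iys k.
rewrite ger0_norm; last by rewrite mulr_ge0// ltW.
apply: le_trans (_ : top * beta^-1 ^+ n <= _).
  by rewrite mulrC exprVn ler_pM2r// ltW.
have /ltW := hn1 n n1n; apply: le_trans; exact: ler_norm.
Qed.

(** The countable set of points with a residual at an end of the interval,
    where the open and the closed interval may give different counts. *)
Definition exceptional : set R := [set x | exists w, residual w x = 0 \/ residual w x = top].

Lemma nb_prefixesE n x : ~ exceptional x -> nb_prefixes beta m n x = size (residuals n x).
Proof.
move=> nx; rewrite size_res_count -card_tuples /nb_prefixes /prefixes.
apply: eq_card => w; rewrite !inE; apply/asboolP/idP => [[e [ew ex]]|Iw].
  have wE : mkseq e n = w.
    apply: (@eq_from_nth _ (e 0%N)); first by rewrite size_mkseq size_tuple.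
    rewrite size_mkseq => i i_n; rewrite nth_mkseq// (ew (Ordinal i_n)).
    by rewrite (tnth_nth (e 0%N)).
  have := expansion_residual n ex; rewrite wE /inI !le_eqVlt => /andP[].
  case/orP => [/eqP h|->]; first by case: nx; exists w; left.
  by case/orP => [/eqP h|->//]; case: nx; exists w; right.
have [e [ew ex]] := residual_expansion Iw; exists e; split => // i.
rewrite (tnth_nth (e 0%N)) -[in RHS]ew size_tuple nth_mkseq//.
Qed.

Lemma residual_inj w : injective (residual w).
Proof.
elim: w => [|d w IH] x y //= /IH /addIr /mulfI; apply.
by rewrite gt_eqF// (@beta_gt0 _ _ m).
Qed.

Lemma lam_residual_level w c : lam [set x | residual w x = c] = 0%E.
Proof.
case: (pselect (exists x, residual w x = c)) => [[x xc]|nx].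
  have E := lam_itv (lexx x); rewrite subrr in E.
  apply: lam0_sub E => y /=; rewrite -xc => /residual_inj ->.
  by rewrite in_itv /= lexx.
rewrite (_ : [set x | _] = set0); last first.
  by apply/seteqP; split => x //= xc; apply: nx; exists x.
by rewrite /lam outer_measure0.
Qed.

Lemma lam_exceptional : lam exceptional = 0%E.
Proof.
apply: (@lam0_layers _ _ digit_words
  (fun w => [set x | residual w x = 0] `|` [set x | residual w x = top])) => [x [w h]|n w _].
  by exists (size w), w; [rewrite mem_digit_words|].
by apply: lam0U; exact: lam_residual_level.
Qed.

End Expansions.

Theorem theorem1p1 (R : realType) (beta : R) (m : nat)
    (hbeta : Pisot beta) (hm : beta < m%:R) :
  exists gamma : R, 0 < gamma /\
    {ae @lebesgue_measure R, forall x : R,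
       x \in `[0, (m%:R - 1) / (beta - 1)] ->
       (fun n : nat => ln (nb_prefixes beta m n x)%:R / n%:R) @ \oo --> gamma}.
Proof.
have [_ b1 _] := hbeta.
have hb : expanding beta m by split.
have [V hV] := res_diff_finite m hbeta.
have [a [b [t [i [a0 ab bt hab large]]]]] := good_itv hV.
have [S fS] := filling_ex a0 ab bt (ltW a0) ab (ltW bt).
have top0 : 0 < top beta m by exact: top_gt0.
have [S0 fS0] := filling_ex a0 ab bt (lexx 0) top0 (lexx _).
have [g g0 hg] := rate_ex hV a0 ab bt hab large fS.
exists g; split => //.
apply/negligible_outer_measure.
have Z : lam [set x | inI beta m x /\ ~ has_rate (fun n => ln_count beta m n x) g] = 0%E.
  exact: (rate_ae_top hV a0 ab bt hab fS g0 hg fS0).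
have E : lam (exceptional beta m) = 0%E by exact: lam_exceptional.
apply: (lam0_sub _ (lam0U Z E)) => x /= nx.
apply: contrapT => nr; apply: nx => xI.
have ne : ~ exceptional beta m x by move=> ex; apply: nr; right.
have Ix : inI beta m x.
  move: xI; rewrite in_itv /= -/(top beta m) /inI !le_eqVlt => /andP[].
  case/orP => [/eqP h|->]; first by case: ne; exists [::]; left.
  by case/orP => [/eqP h|->//]; case: ne; exists [::]; right.
rewrite (_ : (fun n => _) = fun n => ln_count beta m n x / n%:R); last first.
  by apply/funext => n; rewrite nb_prefixesE.
apply: has_rate_cvg; apply: contrapT => nh; apply: nr; left; split => //.
Qed.
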